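(* Let $\pi\colon M\to N$ be the (locally defined) canonical submersion of a $3$-$(\alpha,\delta)$-Sasaki manifold $M$ of dimension $4n+3$. Then the scalar curvature of the base $(N,g_N)$ is $$\mathrm{scal}_{g_N}=16n(n+2)\alpha\delta.$$
   Context: An almost contact metric structure $(\varphi,\xi,\eta,g)$ on an odd-dimensional manifold consists of a $(1,1)$-tensor field $\varphi$, a vector field $\xi$, a $1$-form $\eta$ and a Riemannian metric $g$ with $\varphi^2=-I+\eta\otimes\xi$, $\eta(\xi)=1$, $\varphi\xi=0$, $\eta\circ\varphi=0$, $g(\varphi X,\varphi Y)=g(X,Y)-\eta(X)\eta(Y)$. An almost $3$-contact metric manifold $(M,\varphi_i,\xi_i,\eta_i,g)$ is a manifold of dimension $4n+3$ with three almost contact metric structures $(\varphi_i,\xi_i,\eta_i,g)$, $i=1,2,3$, sharing the metric $g$, such that for every even permutation $(ijk)$ of $(123)$: $\varphi_k=\varphi_i\varphi_j-\eta_j\otimes\xi_i=-\varphi_j\varphi_i+\eta_i\otimes\xi_j$, $\xi_k=\varphi_i\xi_j=-\varphi_j\xi_i$, $\eta_k=\eta_i\circ\varphi_j=-\eta_j\circ\varphi_i$. Put $\mathcal V=\langle\xi_1,\xi_2,\xi_3\rangle$, $\mathcal H=\bigcap_i\ker\eta_i$ and $\Phi_i(X,Y)=g(X,\varphi_iY)$. It is a $3$-$(\alpha,\delta)$-Sasaki manifold, with real constants $\alpha\neq0$ and $\delta$, if $d\eta_i=2\alpha\Phi_i+2(\alpha-\delta)\eta_j\wedge\eta_k$ for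 every even permutation $(ijk)$ of $(123)$. Conventions: $d\eta(X,Y)=X(\eta(Y))-Y(\eta(X))-\eta([X,Y])$ and $(\eta\wedge\eta')(X,Y)=\eta(X)\eta'(Y)-\eta(Y)\eta'(X)$. The canonical submersion of $M$ is the locally defined Riemannian submersion $\pi\colon M\to N$ onto a Riemannian manifold $(N,g_N)$ whose vertical distribution $\ker\pi_*$ is $\mathcal V$ (here $M$ stands for a sufficiently small open subset on which $\pi$ is defined). *)

(* Defs.v *)
From mathcomp Require Import all_boot all_order all_fingroup all_algebra.
From mathcomp Require Import all_classical all_reals all_analysis.
Set Implicit Arguments.
Unset Strict Implicit.
Unset Printing Implicit Defensive.
Import Order.TTheory GRing.Theory Num.Theory.
Import numFieldNormedType.Exports.
Local Open Scope classical_set_scope.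
Local Open Scope ring_scope.

(* Points of coordinate space and tangent vectors are column vectors
   'cV[R]_m, covectors are row vectors 'rV[R]_m, endomorphisms of the tangent
   space are matrices acting on columns from the left (so that composition is
   the matrix product, and eta (x) xi is the matrix  xi *m eta), and a bilinear
   form is given by its Gram matrix. *)

Section Calculus.
Context {R : realType} {m : nat}.
Implicit Types (U : set 'cV[R]_m) (f : 'cV[R]_m -> R).

Definition partial (i : 'I_m) f (x : 'cV[R]_m) : R := 'D_(delta_mx i 0) f x.

(* C^k on U; it is only used for U open. *)
Fixpoint Ck (k : nat) U f : Prop :=
  (forall x, U x -> {for x, continuous f}) /\
  if k is k'.+1 then
    forall i, (forall x, U x -> derivable f x (delta_mx i 0)) /\
              Ck k' U (partial i f)
  else True.

Definition smooth U f : Prop := forall k, Ck k U f.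

Definition smooth_mx (p q : nat) U (F : 'cV[R]_m -> 'M[R]_(p, q)) : Prop :=
  forall i j, smooth U (fun x => F x i j).

Definition jacobian_mx (p : nat) (F : 'cV[R]_m -> 'cV[R]_p) (x : 'cV[R]_m) :
    'M[R]_(p, m) :=
  \matrix_(i, j) partial j (fun y => F y i 0) x.

Definition pairing (w : 'rV[R]_m) (v : 'cV[R]_m) : R := (w *m v) 0 0.

Definition bilin (G : 'M[R]_m) (v w : 'cV[R]_m) : R := (v^T *m G *m w) 0 0.

Definition wedge (w w' : 'rV[R]_m) (u v : 'cV[R]_m) : R :=
  pairing w u * pairing w' v - pairing w v * pairing w' u.

Definition along (X : 'cV[R]_m -> 'cV[R]_m) f (x : 'cV[R]_m) : R :=
  'D_(X x) f x.

Definition bracket (X Y : 'cV[R]_m -> 'cV[R]_m) (x : 'cV[R]_m) : 'cV[R]_m :=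
  \col_i (along X (fun y => Y y i 0) x - along Y (fun y => X y i 0) x).

Definition ext_d (w : 'cV[R]_m -> 'rV[R]_m) (X Y : 'cV[R]_m -> 'cV[R]_m)
    (x : 'cV[R]_m) : R :=
  along X (fun y => pairing (w y) (Y y)) x
  - along Y (fun y => pairing (w y) (X y)) x
  - pairing (w x) (bracket X Y x).

Section Curvature.
Variable G : 'cV[R]_m -> 'M[R]_m.

(* [christoffel k i j] is Gamma^k_{ij} for the Levi-Civita connection of G. *)
Definition christoffel (k i j : 'I_m) (x : 'cV[R]_m) : R :=
  2^-1 * \sum_l invmx (G x) k l *
    (partial i (fun y => G y j l) x + partial j (fun y => G y i l) x
     - partial l (fun y => G y i j) x).

(* [riemann l k i j] is the l-th component of R(d_i, d_j) d_k, where
   R(X,Y) = [nabla_X, nabla_Y] - nabla_[X,Y]. *)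
Definition riemann (l k i j : 'I_m) (x : 'cV[R]_m) : R :=
  partial i (christoffel l j k) x - partial j (christoffel l i k) x
  + \sum_p (christoffel l i p x * christoffel p j k x
            - christoffel l j p x * christoffel p i k x).

(* Ric(Y,Z) is the trace of X |-> R(X,Y)Z. *)
Definition ricci (j k : 'I_m) (x : 'cV[R]_m) : R := \sum_i riemann i k i j x.

Definition scalar_curvature (x : 'cV[R]_m) : R :=
  \sum_j \sum_k invmx (G x) j k * ricci j k x.

End Curvature.
End Calculus.

(* [cmap] and [cinv] are total functions, only meaningful on [cdom] and on
   [crange] respectively. *)
Record chart (R : realType) (m : nat) (T : topologicalType) := Chart {
  cdom : set T;
  cmap : T -> 'cV[R]_m;
  cinv : 'cV[R]_m -> T }.

Definition crange (R : realType) m (T : topologicalType) (c : chart R m T) :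
  set 'cV[R]_m := cmap c @` cdom c.

Record is_chart (R : realType) m (T : topologicalType) (c : chart R m T) :
    Prop := IsChart {
  chart_open_dom : open (cdom c);
  chart_open_range : open (crange c);
  chart_mapK : forall p, cdom c p -> cinv c (cmap c p) = p;
  chart_map_cont : {within cdom c, continuous (cmap c)};
  chart_inv_cont : {within crange c, continuous (cinv c)} }.

Definition overlap (R : realType) m (T : topologicalType)
  (c c' : chart R m T) : set 'cV[R]_m := cmap c @` (cdom c `&` cdom c').

Definition transition (R : realType) m (T : topologicalType)
  (c c' : chart R m T) : 'cV[R]_m -> 'cV[R]_m := cmap c' \o cinv c.

Record manifold (R : realType) (m : nat) := Manifold {
  carrier :> topologicalType;
  atlas : set (chart R m carrier);
  manifold_hausdorff : hausdorff_space carrier;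
  manifold_second_countable : @second_countable carrier;
  atlas_chart : forall c, atlas c -> is_chart c;
  atlas_cover : forall p, exists2 c, atlas c & cdom c p;
  atlas_smooth : forall c c', atlas c -> atlas c' ->
    smooth_mx (overlap c c') (transition c c') }.

(* A tensor field is given by its components in every chart of the atlas,
   subject to smoothness and to the usual transformation law. *)

Record vector_field (R : realType) m (M : manifold R m) := VectorField {
  vf_comp :> chart R m M -> 'cV[R]_m -> 'cV[R]_m;
  vf_smooth : forall c, atlas c -> smooth_mx (crange c) (vf_comp c);
  vf_transform : forall c c', atlas c -> atlas c' ->
    forall x, overlap c c' x ->
    vf_comp c' (transition c c' x) =
      jacobian_mx (transition c c') x *m vf_comp c x }.

Record one_form (R : realType) m (M : manifold R m) := OneForm {
  of_comp :> chart R m M -> 'cV[R]_m -> 'rV[R]_m;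
  of_smooth : forall c, atlas c -> smooth_mx (crange c) (of_comp c);
  of_transform : forall c c', atlas c -> atlas c' ->
    forall x, overlap c c' x ->
    of_comp c x =
      of_comp c' (transition c c' x) *m jacobian_mx (transition c c') x }.

Record endo_field (R : realType) m (M : manifold R m) := EndoField {
  ef_comp :> chart R m M -> 'cV[R]_m -> 'M[R]_m;
  ef_smooth : forall c, atlas c -> smooth_mx (crange c) (ef_comp c);
  ef_transform : forall c c', atlas c -> atlas c' ->
    forall x, overlap c c' x ->
    ef_comp c' (transition c c' x) *m jacobian_mx (transition c c') x =
      jacobian_mx (transition c c') x *m ef_comp c x }.

Record riemannian_metric (R : realType) m (M : manifold R m) :=
    RiemannianMetric {
  rm_comp :> chart R m M -> 'cV[R]_m -> 'M[R]_m;
  rm_smooth : forall c, atlas c -> smooth_mx (crange c) (rm_comp c);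
  rm_transform : forall c c', atlas c -> atlas c' ->
    forall x, overlap c c' x ->
    rm_comp c x =
      (jacobian_mx (transition c c') x)^T *m rm_comp c' (transition c c' x)
        *m jacobian_mx (transition c c') x;
  rm_sym : forall c, atlas c -> forall x, crange c x ->
    (rm_comp c x)^T = rm_comp c x;
  rm_pos : forall c, atlas c -> forall x, crange c x ->
    forall v, v != 0 -> 0 < bilin (rm_comp c x) v v }.

(* A (tensorial) pointwise condition, required in every chart. *)
Definition everywhere (R : realType) m (M : manifold R m)
    (P : chart R m M -> 'cV[R]_m -> Prop) : Prop :=
  forall c, atlas c -> forall x, crange c x -> P c x.

Record almost_contact_metric (R : realType) m (M : manifold R m)
    (phi : endo_field M) (xi : vector_field M) (eta : one_form M)
    (g : riemannian_metric M) : Prop := AlmostContactMetric {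
  acm_phi_sqr : everywhere (fun c x =>
    phi c x *m phi c x = - 1%:M + xi c x *m eta c x);
  acm_eta_xi : everywhere (fun c x => pairing (eta c x) (xi c x) = 1);
  acm_phi_xi : everywhere (fun c x => phi c x *m xi c x = 0);
  acm_eta_phi : everywhere (fun c x => eta c x *m phi c x = 0);
  acm_metric : everywhere (fun c x => forall u v,
    bilin (g c x) (phi c x *m u) (phi c x *m v) =
    bilin (g c x) u v - pairing (eta c x) u * pairing (eta c x) v) }.

Definition even_triple (i j k : 'I_3) : Prop :=
  exists2 s : 'S_3, ~~ odd_perm s & [/\ i = s 0, j = s 1 & k = s 2].

Record almost_3_contact_metric (R : realType) m (M : manifold R m)
    (phi : 'I_3 -> endo_field M) (xi : 'I_3 -> vector_field M)
    (eta : 'I_3 -> one_form M) (g : riemannian_metric M) : Prop :=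
    Almost3ContactMetric {
  a3c_acm : forall i, almost_contact_metric (phi i) (xi i) (eta i) g;
  a3c_phi : forall i j k, even_triple i j k -> everywhere (fun c x =>
    phi k c x = phi i c x *m phi j c x - xi i c x *m eta j c x /\
    phi k c x = - (phi j c x *m phi i c x) + xi j c x *m eta i c x);
  a3c_xi : forall i j k, even_triple i j k -> everywhere (fun c x =>
    xi k c x = phi i c x *m xi j c x /\
    xi k c x = - (phi j c x *m xi i c x));
  a3c_eta : forall i j k, even_triple i j k -> everywhere (fun c x =>
    eta k c x = eta i c x *m phi j c x /\
    eta k c x = - (eta j c x *m phi i c x)) }.

(* Both sides of the structure equation are tensorial in X and Y, so testing
   it on vector fields defined on the chart domain is the same as testing it
   on global vector fields. *)
Record three_alpha_delta_Sasaki (R : realType) m (M : manifold R m)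
    (alpha delta : R)
    (phi : 'I_3 -> endo_field M) (xi : 'I_3 -> vector_field M)
    (eta : 'I_3 -> one_form M) (g : riemannian_metric M) : Prop :=
    ThreeAlphaDeltaSasaki {
  s3_a3c : almost_3_contact_metric phi xi eta g;
  s3_alpha : alpha != 0;
  s3_d : forall i j k, even_triple i j k -> everywhere (fun c x =>
    forall X Y, smooth_mx (crange c) X -> smooth_mx (crange c) Y ->
    ext_d (eta i c) X Y x =
      2 * alpha * bilin (g c x) (X x) (phi i c x *m Y x)
      + 2 * (alpha - delta) * wedge (eta j c x) (eta k c x) (X x) (Y x)) }.

Definition in_charts (R : realType) m p (M : manifold R m) (N : manifold R p)
  (f : M -> N) (c : chart R m M) (c' : chart R p N) :
  'cV[R]_m -> 'cV[R]_p := cmap c' \o f \o cinv c.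

Definition smooth_map (R : realType) m p (M : manifold R m)
    (N : manifold R p) (f : M -> N) : Prop :=
  continuous f /\
  forall c c', atlas c -> atlas c' ->
    smooth_mx (cmap c @` (cdom c `&` f @^-1` cdom c')) (in_charts f c c').

Definition tangent_map (R : realType) m p (M : manifold R m)
  (N : manifold R p) (f : M -> N) (c : chart R m M) (c' : chart R p N)
  (x : 'cV[R]_m) : 'M[R]_(p, m) := jacobian_mx (in_charts f c c') x.

Record riemannian_submersion (R : realType) m p (M : manifold R m)
    (N : manifold R p) (gM : riemannian_metric M) (gN : riemannian_metric N)
    (f : M -> N) : Prop := RiemannianSubmersion {
  rs_smooth : smooth_map f;
  rs_onto : forall q, exists a, f a = q;
  rs_submersion : forall c c' a, atlas c -> atlas c' ->
    cdom c a -> cdom c' (f a) ->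
    forall w : 'cV[R]_p, exists v : 'cV[R]_m,
      tangent_map f c c' (cmap c a) *m v = w;
  rs_isometry : forall c c' a, atlas c -> atlas c' ->
    cdom c a -> cdom c' (f a) ->
    let T := tangent_map f c c' (cmap c a) in
    let horizontal (u : 'cV[R]_m) :=
      forall w : 'cV[R]_m, T *m w = 0 -> bilin (gM c (cmap c a)) u w = 0 in
    forall u v, horizontal u -> horizontal v ->
    bilin (gN c' (cmap c' (f a))) (T *m u) (T *m v) =
    bilin (gM c (cmap c a)) u v }.

(* A Riemannian submersion with ker f_* = < xi_1, xi_2, xi_3 >. *)
Record canonical_submersion (R : realType) m p (M : manifold R m)
    (N : manifold R p) (xi : 'I_3 -> vector_field M)
    (gM : riemannian_metric M) (gN : riemannian_metric N) (f : M -> N) :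
    Prop := CanonicalSubmersion {
  cs_submersion : riemannian_submersion gM gN f;
  cs_vertical : forall c c' a, atlas c -> atlas c' ->
    cdom c a -> cdom c' (f a) ->
    forall v : 'cV[R]_m, tangent_map f c c' (cmap c a) *m v = 0 <->
      exists b : 'I_3 -> R, v = \sum_i b i *: xi i c (cmap c a) }.

(* Main.v *)
From HB Require Import structures.
Require Import Defs.
From mathcomp Require Import all_boot all_order all_fingroup all_algebra.
From mathcomp Require Import all_classical all_reals all_analysis.
From mathcomp Require Import ring lra.
Import Order.TTheory GRing.Theory Num.Theory.
Import numFieldNormedType.Exports.
Local Open Scope classical_set_scope.
Local Open Scope ring_scope.

(** The three structures phi_i induce almost complex structures on the horizontal
    spaces. These are parallel in the horizontal directions, but the Reeb fields
    xi_i rotate them. Since the bracket of two horizontal lifts is vertical,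
    the curvature of the base sees this rotation, and a trace of it is the
    scalar curvature. The computation takes place on an open set U of the
    total space, to which functions on the base are pulled back by F.

    Let E_a be the horizontal lifts of the coordinate fields of the base, h its
    metric, and put P_i(a,b) = g(E_a, phi_i E_b), so that P_i = h J_i with J_i
    the endomorphism induced by phi_i on the horizontal spaces; J_1, J_2, J_3
    satisfy the quaternion relations. The equation for d eta_i gives
    [[
      [E_a, E_b] = - 2 alpha sum_l P_l(a,b) xi_l,   [xi_l, E_c] = 0,
      [xi_j, xi_k] = 2 delta xi_i   for (ijk) even.
    ]]
    The Jacobi identity for three lifts says that the cyclic sum of
    E_c P_l(a,b) vanishes ([dP_cyclic]), that is, that all three forms P_l are
    closed in the horizontal directions; for one xi and two lifts it says that
    the xi_i rotate the P_l with speed 2 delta ([dP_xi]).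

    As for hyperkaehler manifolds (Hitchin), three closed forms of this kind
    are parallel ([quat_derivation_eq0], [P_parallel]): horizontally, the P_l
    and h are parallel for the pulled back Levi-Civita connection of h. For a
    parallel form the commutator of E_a and E_b is the action of the curvature
    R(a,b) of the base, and it is also - 2 alpha sum_l P_l(a,b) xi_l. Hence
    ([curvature_J])
    [[
      [J_i, R(a,b)] = 4 alpha delta (P_j(a,b) J_k - P_k(a,b) J_j).
    ]]
    The trace of this identity against J_j gives tr (R(a,b) J_k) as a multiple
    of P_k; the first Bianchi identity computes the same trace from the Ricci
    tensor. Comparing the two determines the scalar curvature
    ([scalar_curvature_mx]).

    The analytic input is elementary: functions with continuous partial
    derivatives are differentiable ([C1_differentiable_at]), and mixed partial
    derivatives commute ([partialC]). *)

Set Implicit Arguments.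
Unset Strict Implicit.
Unset Printing Implicit Defensive.

(** * Continuous partial derivatives imply differentiability *)

Section ContinuousPartials.
Context {R : realType} {m : nat}.
Implicit Types (U : set 'cV[R]_m) (f : 'cV[R]_m -> R).

Lemma is_derive_line f p v t : derivable f (t *: v + p) v ->
  is_derive t (1 : R) (fun s : R => f (s *: v + p)) ('D_v f (t *: v + p)).
Proof.
move=> df.
have E : (fun h : R => h^-1 *: ((fun s : R => f (s *: v + p)) (h *: (1 : R) + t)
    - f (t *: v + p))) = (fun h : R => h^-1 *: (f (h *: v + (t *: v + p)) - f (t *: v + p))).
  by apply/funext => h; rewrite [h *: 1]mulr1 scalerDl addrA.
by split; rewrite /derivable /derive /= E.
Qed.

(** The increment s may be negative, which is what the coordinatewise
    telescoping below requires. *)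
Lemma MVT_line f p v s :
  (forall t, `|t| <= `|s| -> derivable f (t *: v + p) v) ->
  exists2 t, `|t| <= `|s| & f (s *: v + p) - f p = s * 'D_v f (t *: v + p).
Proof.
move=> df; pose k t := f (t *: v + p).
have dk t : `|t| <= `|s| -> is_derive t (1 : R) k ('D_v f (t *: v + p)).
  by move=> /df; exact: is_derive_line.
have kc a b : (forall t, t \in `[a, b]%R -> `|t| <= `|s|) ->
    {within `[a, b], continuous k}.
  move=> H; apply: derivable_within_continuous => t /H /dk [] //.
have k0 : k 0 = f p by rewrite /k scale0r add0r.
have [s0|s0] := leP 0 s.
  have H t : t \in `[0, s]%R -> `|t| <= `|s|.
    by rewrite in_itv /= => /andP[? ?]; rewrite !ger0_norm.
  have [||t /H ts e] := @MVT_segment R k (fun t => 'D_v f (t *: v + p)) 0 s s0.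
  - by move=> t t0; apply/dk/H; exact: subset_itv_oo_cc.
  - exact: kc.
  by exists t => //; rewrite -k0 e subr0 mulrC.
have H t : t \in `[s, 0]%R -> `|t| <= `|s|.
  by rewrite in_itv /= => /andP[? ?]; rewrite !ler0_norm// ?lerN2 // ltW.
have [||t /H ts e] := @MVT_segment R k (fun t => 'D_v f (t *: v + p)) s 0 (ltW s0).
- by move=> t t0; apply/dk/H; exact: subset_itv_oo_cc.
- exact: kc.
by exists t => //; rewrite -k0 -opprB e sub0r mulrN opprK mulrC.
Qed.

Lemma mx_norm_entry p q (A : 'M[R]_(p, q)) i j : `|A i j| <= `|A|.
Proof.
rewrite [leRHS]/Num.Def.normr/= mx_normrE.
exact: (le_bigmax _ (fun ij => `|A ij.1 ij.2|) (i, j)).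
Qed.

Lemma mx_norm_le p q (A : 'M[R]_(p, q)) e : 0 <= e ->
  (forall i j, `|A i j| <= e) -> `|A| <= e.
Proof.
move=> e0 H; rewrite [leLHS]/Num.Def.normr/= mx_normrE bigmax_le//.
Qed.

Lemma pairing_sum (w : 'rV[R]_m) v : pairing w v = \sum_i w 0 i * v i 0.
Proof. by rewrite /pairing mxE. Qed.

Lemma pairing_is_linear (w : 'rV[R]_m) : linear_for *%R (pairing w).
Proof. by move=> a u v; rewrite /pairing mulmxDr -scalemxAr !mxE. Qed.

HB.instance Definition _ (w : 'rV[R]_m) :=
  GRing.isLinear.Build R 'cV[R]_m R *%R (pairing w) (pairing_is_linear w).

Lemma continuous_pairing (w : 'rV[R]_m) : continuous (pairing w).
Proof.
have -> : pairing w = (fun v => \sum_i w 0 i * v i 0) by apply/funext => v; exact: pairing_sum.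
move=> v; apply: differentiable_continuous; rewrite -fct_sumE.
apply: differentiable_sum => i; apply: differentiableM.
  exact: differentiable_cst.
exact: differentiable_coord.
Qed.

(** The vertices of the broken line from 0 to h which follows the coordinate
    axes one after the other. *)
Definition trunc k (h : 'cV[R]_m) := \col_(i < m) (if (i < k)%N then h i 0 else 0).

Lemma truncS (h : 'cV[R]_m) (k : 'I_m) :
  trunc k.+1 h = h k 0 *: delta_mx k 0 + trunc k h.
Proof.
apply/colP => i; rewrite !mxE eqxx andbT ltnS leq_eqVlt.
have [->|ne] := eqVneq i k; first by rewrite eqxx ltnn mulr1 addr0.
by rewrite [X in X || _](_ : _ = false) ?mulr0 ?add0r //; apply/negbTE.
Qed.

(** The increment of f is telescoped along the broken line [trunc]; on each of
    the m segments the mean value theorem replaces it by a partial derivative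
    at a point close to x, which continuity compares with the one at x. *)
Lemma C1_differentiable_at U f x : open U -> U x ->
  (forall y i, U y -> derivable f y (delta_mx i 0)) ->
  (forall i, {for x, continuous (partial i f)}) ->
  differentiable f x.
Proof.
move=> oU Ux df cf.
pose w := \row_i partial i f x.
suff H : (f : _ -> R^o) \o shift x = cst (f x) + (pairing w : _ -> R^o) +o_ (0 : 'cV[R]_m) id.
  have e := diff_unique (@continuous_pairing w) H.
  by apply/diff_locallyP; rewrite e; split => //; exact: continuous_pairing.
apply/eqaddoP => _/posnumP[e].
(* each of the m segments contributes at most e' times the norm of h;
   m.+1 avoids a division by zero when m = 0 *)
pose e' := e%:num / m.+1%:R.
have e'0 : 0 < e' by rewrite divr_gt0.
have Hp : \forall y \near x, forall i, `|partial i f x - partial i f y| <= e'.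
  have := @filter_forall _ 'I_m (fun i y => `|partial i f x - partial i f y| <= e') (nbhs x) _.
  apply => i; have /cvgrPdist_le/(_ _ e'0) := cf i; exact.
have : \forall y \near x, U y /\ forall i, `|partial i f x - partial i f y| <= e'.
  apply: filterI; first exact: open_nbhs_nbhs.
  exact: Hp.
move=> /nbhs_ballP[d /= d0 xd].
apply/nbhs_ballP; exists d => //= h; rewrite -ball_normE /= sub0r normrN => hd.
have Hin (k : nat) (y : 'cV[R]_m) : (forall i, `|y i 0| <= `|h|) -> ball x d (y + x).
  move=> yh; rewrite -ball_normE /= opprD addrCA subrr addr0 normrN.
  by apply: le_lt_trans hd; apply: mx_norm_le => // i j; rewrite ord1.
have tr_le k i : `|trunc k h i 0| <= `|h|.
  by rewrite mxE; case: ifP => _; rewrite ?normr0 ?mx_norm_entry.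
have -> : (f \o shift x - (cst (f x) + pairing w)) h =
    \sum_(k < m) (f (trunc k.+1 h + x) - f (trunc k h + x) - w 0 k * h k 0).
  rewrite sumrB -pairing_sum.
  rewrite -(big_mkord xpredT (fun k => f (trunc k.+1 h + x) - f (trunc k h + x))).
  rewrite (telescope_sumr (fun k => f (trunc k h + x))) //.
  have -> : trunc m h = h by apply/colP => i; rewrite mxE ltn_ord.
  have -> : trunc 0 h = 0 by apply/colP => i; rewrite !mxE.
  by rewrite add0r opprD addrA.
apply: le_trans (ler_norm_sum _ _ _) _.
apply: (@le_trans _ _ (\sum_(k < m) e' * `|h|)).
  apply: ler_sum => k _; rewrite truncS.
  have Hline t : `|t| <= `|h k 0| -> ball x d (t *: delta_mx k 0 + (trunc k h + x)).
    move=> tk; rewrite addrA; apply: Hin => // i; rewrite !mxE eqxx andbT.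
    have [->|ne] := eqVneq i k; first by rewrite ltnn addr0 mulr1 (le_trans tk) ?mx_norm_entry.
    by rewrite mulr0 add0r; have := tr_le k i; rewrite mxE.
  have [t tk] := @MVT_line f (trunc k h + x) (delta_mx k 0) (h k 0)
    (fun t tk => df _ _ (xd _ (Hline t tk)).1).
  rewrite addrA => ->; rewrite mxE mulrC -mulrBl normrM distrC.
  apply: ler_pM => //; last exact: mx_norm_entry.
  by have [_] := xd _ (Hline t tk).
rewrite sumr_const card_ord -mulr_natl mulrA ler_wpM2r//.
rewrite /e' mulrCA ler_piMr// ler_pdivrMr // mul1r ler_nat //.
Qed.
End ContinuousPartials.

(** * Closure properties of smooth functions *)

Section SmoothFunctions.
Context {R : realType} {m : nat}.
Implicit Types (U : set 'cV[R]_m) (f g : 'cV[R]_m -> R).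

Lemma Ck_continuous k U f x : Ck k U f -> U x -> {for x, continuous f}.
Proof. by case: k => [|k] [H _] Ux; exact: H. Qed.

Lemma CkS k U f : Ck k.+1 U f -> Ck k U f.
Proof.
elim: k f => [|k IH] f [cf H]; first by split.
by split=> // i; have [d Hi] := H i; split=> //; exact: IH.
Qed.

Lemma Ck_sub k U U' f : U' `<=` U -> Ck k U f -> Ck k U' f.
Proof.
move=> s; elim: k f => [|k IH] f [cf H]; split=> //; try by move=> x /s /cf.
by move=> i; have [d Hi] := H i; split; [move=> x /s /d|exact: IH].
Qed.

Lemma near_open_eq U f g x : open U -> U x -> (forall y, U y -> f y = g y) ->
  \forall y \near x, f y = g y.
Proof. by move=> oU Ux H; apply: (filterS H); exact: open_nbhs_nbhs. Qed.

Lemma derive_open_eq U f g x v : open U -> U x -> (forall y, U y -> f y = g y) ->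
  'D_v f x = 'D_v g x.
Proof. by move=> oU Ux H; apply: near_eq_derive; exact: near_open_eq H. Qed.

Lemma continuous_open_eq U f g x : open U -> U x -> (forall y, U y -> f y = g y) ->
  {for x, continuous f} -> {for x, continuous g}.
Proof.
move=> oU Ux fg; rewrite /prop_for /continuous_at (fg x Ux) => H.
apply: cvg_trans H; apply: (@near_eq_cvg _ _ (nbhs x)); exact: near_open_eq fg.
Qed.

Lemma eq_Ck k U f g : open U -> (forall y, U y -> f y = g y) ->
  Ck k U f -> Ck k U g.
Proof.
move=> oU; elim: k f g => [|k IH] f g fg [cf H]; split=> //;
  try by move=> x Ux; exact: continuous_open_eq fg (cf x Ux).
move=> i; have [d Hi] := H i; split.
  move=> x Ux; apply: near_eq_derivable (d x Ux); exact: near_open_eq fg.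
by apply: IH Hi => y Uy; exact: derive_open_eq fg.
Qed.

Lemma Ck_differentiable k U f x : open U -> Ck k.+1 U f -> U x -> differentiable f x.
Proof.
move=> oU [cf H] Ux; apply: (C1_differentiable_at oU Ux) => [y i Uy|i].
  by have [d _] := H i; exact: d.
by have [_ Hi] := H i; exact: Ck_continuous Hi Ux.
Qed.

Lemma derive_partials f x v : differentiable f x ->
  'D_v f x = \sum_i v i 0 * partial i f x.
Proof.
move=> d; rewrite /partial (eq_bigr (fun i => v i 0 * 'd f x (delta_mx i 0))) => [|i _]; last by rewrite deriveE.
rewrite (deriveE _ d) {1}(_ : v = \sum_i v i 0 *: delta_mx i 0).
  by rewrite linear_sum; apply: eq_bigr => i _; rewrite linearZ.
by rewrite {1}(matrix_sum_delta v); apply: eq_bigr => i _; rewrite big_ord1.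
Qed.

Lemma Ck_cst k U (a : R) : Ck k U (fun=> a).
Proof.
elim: k a => [|k IH] a; split=> //; try by move=> x _; exact: cst_continuous.
move=> i; split=> [y _|]; first by apply: (@derivable_cst R _ _ a).
suff -> : partial i (fun=> a) = (fun=> 0) :> ('cV[R]_m -> R) by exact: IH.
by apply/funext => x; exact: derive_cst.
Qed.

Lemma CkD k U f g : open U -> Ck k U f -> Ck k U g -> Ck k U (fun x => f x + g x).
Proof.
move=> oU; elim: k f g => [|k IH] f g [cf Hf] [cg Hg]; split=> //.
- by move=> x Ux; apply: continuousD; [exact: cf|exact: cg].
- by move=> x Ux; apply: continuousD; [exact: cf|exact: cg].
move=> i; have [df H1] := Hf i; have [dg H2] := Hg i; split.
  by move=> x Ux; apply: derivableD; [exact: df|exact: dg].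
apply: (@eq_Ck k U _ _ oU _ (IH _ _ H1 H2)) => x Ux.
by rewrite /partial deriveD //; [exact: df|exact: dg].
Qed.

Lemma CkM k U f g : open U -> Ck k U f -> Ck k U g -> Ck k U (fun x => f x * g x).
Proof.
move=> oU; elim: k f g => [|k IH] f g Cf Cg.
  by move: Cf Cg => [cf Hf] [cg Hg]; split=> // x Ux; apply: continuousM; [exact: cf|exact: cg].
have Cf' := CkS Cf; have Cg' := CkS Cg.
move: Cf Cg => [cf Hf] [cg Hg]; split.
  by move=> x Ux; apply: continuousM; [exact: cf|exact: cg].
move=> i; have [df H1] := Hf i; have [dg H2] := Hg i; split.
  by move=> x Ux; apply: derivableM; [exact: df|exact: dg].
apply: (@eq_Ck k U _ _ oU _ (CkD oU (IH _ _ Cf' H2) (IH _ _ Cg' H1))) => x Ux.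
by rewrite /partial deriveM //; [exact: df|exact: dg].
Qed.

(** The derivative of 1/f is - (1/f) (1/f) f', so C^k for 1/f feeds the
    induction that yields C^(k+1). *)
Lemma CkV k U f : open U -> (forall x, U x -> f x != 0) -> Ck k U f ->
  Ck k U (fun x => (f x)^-1).
Proof.
move=> oU f0; elim: k => [|k IH] Cf.
  by move: Cf => [cf Hf]; split=> // x Ux; apply: continuousV; [exact: f0|exact: cf].
have Cf' := IH (CkS Cf).
move: Cf => [cf Hf]; split.
  by move=> x Ux; apply: continuousV; [exact: f0|exact: cf].
move=> i; have [df H1] := Hf i; split.
  by move=> x Ux; apply: derivableV; [exact: f0|exact: df].
apply: (@eq_Ck k U _ _ oU _ (CkM oU (@Ck_cst k U (-1)) (CkM oU (CkM oU Cf' Cf') H1))) => x Ux.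
rewrite /partial [RHS]deriveV //; [|exact: f0|exact: df].
by rewrite mulN1r scaleNr /GRing.scale /= -exprVn expr2.
Qed.

Lemma smooth_cst U (a : R) : smooth U (fun=> a).
Proof. by move=> k; exact: Ck_cst. Qed.

Lemma smoothD U f g : open U -> smooth U f -> smooth U g -> smooth U (fun x => f x + g x).
Proof. by move=> oU Sf Sg k; exact: CkD. Qed.

Lemma smoothM U f g : open U -> smooth U f -> smooth U g -> smooth U (fun x => f x * g x).
Proof. by move=> oU Sf Sg k; exact: CkM. Qed.

Lemma smoothV U f : open U -> (forall x, U x -> f x != 0) -> smooth U f ->
  smooth U (fun x => (f x)^-1).
Proof. by move=> oU f0 Sf k; exact: CkV. Qed.

Lemma smooth_sub U U' f : U' `<=` U -> smooth U f -> smooth U' f.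
Proof. by move=> s Sf k; exact: Ck_sub (Sf k). Qed.

Lemma eq_smooth U f g : open U -> (forall y, U y -> f y = g y) ->
  smooth U f -> smooth U g.
Proof. by move=> oU fg Sf k; exact: eq_Ck (Sf k). Qed.

Lemma smooth_partial U f i : smooth U f -> smooth U (partial i f).
Proof. by move=> Sf k; have [_ /(_ i)[]] := Sf k.+1. Qed.

Lemma smooth_differentiable U f x : open U -> smooth U f -> U x -> differentiable f x.
Proof. by move=> oU Sf; apply: Ck_differentiable (Sf 1%N). Qed.

Lemma smoothN U f : open U -> smooth U f -> smooth U (fun x => - f x).
Proof.
move=> oU Sf; apply: (eq_smooth oU _ (smoothM oU (smooth_cst U (-1)) Sf)) => x _.
by rewrite mulN1r.
Qed.

Lemma smoothB U f g : open U -> smooth U f -> smooth U g -> smooth U (fun x => f x - g x).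
Proof. by move=> oU Sf Sg; apply: smoothD => //; exact: smoothN. Qed.

Lemma smooth_sum (I : Type) (r : seq I) (P : pred I) U (F : I -> 'cV[R]_m -> R) :
  open U -> (forall i, smooth U (F i)) -> smooth U (fun x => \sum_(i <- r | P i) F i x).
Proof.
move=> oU SF; elim: r => [|a r IH].
  by apply: (eq_smooth oU _ (smooth_cst U 0)) => x _; rewrite big_nil.
case Pa: (P a).
  by apply: (eq_smooth oU _ (smoothD oU (SF a) IH)) => x _; rewrite big_cons Pa.
by apply: (eq_smooth oU _ IH) => x _; rewrite big_cons Pa.
Qed.

Lemma smooth_prod (I : Type) (r : seq I) (P : pred I) U (F : I -> 'cV[R]_m -> R) :
  open U -> (forall i, smooth U (F i)) -> smooth U (fun x => \prod_(i <- r | P i) F i x).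
Proof.
move=> oU SF; elim: r => [|a r IH].
  by apply: (eq_smooth oU _ (smooth_cst U 1)) => x _; rewrite big_nil.
case Pa: (P a).
  by apply: (eq_smooth oU _ (smoothM oU (SF a) IH)) => x _; rewrite big_cons Pa.
by apply: (eq_smooth oU _ IH) => x _; rewrite big_cons Pa.
Qed.

Lemma derive_coord i v (x : 'cV[R]_m) : 'D_v (fun y : 'cV[R]_m => y i 0) x = v i 0.
Proof.
have := @derive_mx R 'cV[R]_m m 1 id x v (@derivable_id _ _ x v).
by rewrite derive_id => /matrixP/(_ i 0); rewrite mxE.
Qed.

Lemma smooth_coord U i : open U -> smooth U (fun y : 'cV[R]_m => y i 0).
Proof.
move=> oU [|k]; split=> //; try by move=> x _; exact: coord_continuous.
move=> j; split=> [x _|]; first by apply: diff_derivable; exact: differentiable_coord.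
apply: (eq_Ck oU _ (@Ck_cst k U (delta_mx j 0 i 0))) => x Ux.
by rewrite /partial derive_coord.
Qed.

Lemma smooth_mxM p q r U (A : 'cV[R]_m -> 'M[R]_(p, q)) (B : 'cV[R]_m -> 'M[R]_(q, r)) :
  open U -> smooth_mx U A -> smooth_mx U B -> smooth_mx U (fun x => A x *m B x).
Proof.
move=> oU SA SB i j.
apply: (eq_smooth oU (f := fun x => \sum_k A x i k * B x k j)) => [x _|].
  by rewrite mxE.
by apply: smooth_sum => // k; exact: smoothM.
Qed.

Lemma smooth_mxT p q U (A : 'cV[R]_m -> 'M[R]_(p, q)) :
  open U -> smooth_mx U A -> smooth_mx U (fun x => (A x)^T).
Proof. by move=> oU SA i j; apply: (eq_smooth oU _ (SA j i)) => x _; rewrite mxE. Qed.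

Lemma smooth_det p U (A : 'cV[R]_m -> 'M[R]_p) :
  open U -> smooth_mx U A -> smooth U (fun x => \det (A x)).
Proof.
move=> oU SA; rewrite /determinant; apply: smooth_sum => // s.
by apply: smoothM => //; [exact: smooth_cst|apply: smooth_prod].
Qed.

(** By Cramer's rule the entries of the inverse are rational functions of those
    of the matrix. *)
Lemma smooth_invmx p U (A : 'cV[R]_m -> 'M[R]_p) :
  open U -> (forall x, U x -> A x \in unitmx) -> smooth_mx U A ->
  smooth_mx U (fun x => invmx (A x)).
Proof.
move=> oU uA SA i j.
apply: (eq_smooth oU (f := fun x => (\det (A x))^-1 *
   ((-1) ^+ (j + i) * \det (row' j (col' i (A x)))))) => [x Ux|].
  by rewrite /invmx uA // !mxE.
apply: smoothM => //.
  apply: smoothV => // [x Ux|]; last exact: smooth_det.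
  by have := uA x Ux; rewrite unitmxE unitfE.
apply: smoothM => //; first exact: smooth_cst.
apply: smooth_det => // k l; apply: (eq_smooth oU _ (SA (lift j k) (lift i l))).
by move=> x _; rewrite !mxE.
Qed.

Lemma smooth_along U (X : 'cV[R]_m -> 'cV[R]_m) f : open U -> smooth_mx U X -> smooth U f ->
  smooth U (along X f).
Proof.
move=> oU SX Sf.
apply: (eq_smooth oU (f := fun x => \sum_i X x i 0 * partial i f x)) => [x Ux|].
  by rewrite /along derive_partials //; exact: smooth_differentiable Sf Ux.
by apply: smooth_sum => // i; apply: smoothM => //; exact: smooth_partial.
Qed.

End SmoothFunctions.

(** * Symmetry of second derivatives, Lie brackets, chain rule *)

Section SecondDerivatives.
Context {R : realType} {m : nat}.
Implicit Types (U : set 'cV[R]_m) (f g : 'cV[R]_m -> R) (X Y : 'cV[R]_m -> 'cV[R]_m).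

Lemma sub_interchange (a b c d : R) : a - b - (c - d) = a - c - (b - d).
Proof. by ring. Qed.

Lemma dist_common (A B a b e s : R) : s != 0 -> s * (s * a) = s * (s * b) ->
  `|A - a| <= e / 2 -> `|B - b| <= e / 2 -> `|A - B| <= e.
Proof.
move=> s0 /(mulfI s0)/(mulfI s0) -> Aa Bb.
by rewrite (le_trans (ler_distD b _ _)) // [X in _ + X]distrC (le_trans (lerD Aa Bb)) // -splitr.
Qed.

Lemma derive_shiftl f (c p v : 'cV[R]_m) :
  (derivable (fun q => f (c + q)) p v <-> derivable f (c + p) v) *
  ('D_v (fun q => f (c + q)) p = 'D_v f (c + p)).
Proof.
have E : (fun h : R => h^-1 *: (((fun q => f (c + q)) \o shift p) (h *: v) - f (c + p)))
   = (fun h : R => h^-1 *: ((f \o shift (c + p)) (h *: v) - f (c + p))).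
  by apply/funext => h /=; rewrite addrCA.
by split; [rewrite /derivable E|rewrite /derive E].
Qed.

(** The second difference of f over a parallelogram with sides s e_i and s e_j
    is symmetric in i and j, whereas applying the mean value theorem twice
    yields the mixed derivatives in a definite order: this is Schwarz's
    argument. *)
Lemma second_difference U f (x : 'cV[R]_m) (i j : 'I_m) (s : R) : Ck 2 U f ->
  (forall y : 'cV[R]_m, (forall k, `|y k 0| <= `|s| + `|s|) -> U (y + x)) ->
  exists2 y : 'cV[R]_m, (forall k, `|y k 0| <= `|s| + `|s|) &
    f (s *: delta_mx i 0 + (s *: delta_mx j 0 + x)) - f (s *: delta_mx i 0 + x)
    - (f (s *: delta_mx j 0 + x) - f x) = s * (s * partial i (partial j f) (y + x)).
Proof.
move=> [_ Hf] HU; have [dfj [_ /(_ i)[dfji _]]] := Hf j.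
set ei : 'cV[R]_m := delta_mx i 0; set ej : 'cV[R]_m := delta_mx j 0.
have small r t : `|r| <= `|s| -> `|t| <= `|s| -> forall k, `|(r *: ei + t *: ej) k 0| <= `|s| + `|s|.
  move=> rs ts k; rewrite !mxE !andbT; apply: le_trans (ler_normD _ _) _.
  by apply: lerD; rewrite normrM normr_nat; case: eqP => _; rewrite ?mulr1 ?mulr0.
have Ht r t : `|r| <= `|s| -> `|t| <= `|s| -> U (r *: ei + (t *: ej + x)).
  by move=> rs ts; rewrite addrA; apply/HU/small.
have Ht0 t : `|t| <= `|s| -> U (t *: ej + x).
  by move=> ts; have := Ht 0 t; rewrite normr0 scale0r add0r; apply.
have [|t ts] := @MVT_line R m (fun q => f (s *: ei + q) - f q) x ej s.
  move=> t ts; apply: derivableB; first by apply/(derive_shiftl _ _ _ _).1/dfj/Ht.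
  exact/dfj/Ht0.
rewrite sub_interchange => ->.
rewrite deriveB ?(derive_shiftl _ _ _ _).2; last 2 first.
- by apply/(derive_shiftl _ _ _ _).1/dfj/Ht.
- exact/dfj/Ht0.
have [|r rs] := @MVT_line R m (partial j f) (t *: ej + x) ei s.
  by move=> r rs; apply/dfji/Ht.
rewrite /partial => ->.
by exists (r *: ei + t *: ej); [exact: small|rewrite addrA].
Qed.

Lemma partialC U f (i j : 'I_m) x : open U -> Ck 2 U f -> U x ->
  partial i (partial j f) x = partial j (partial i f) x.
Proof.
move=> oU Cf Ux; apply/eqP; rewrite -subr_eq0 -normr_le0; apply/ler_addgt0Pr => _/posnumP[e].
rewrite add0r.
have cij k l : {for x, continuous (partial k (partial l f))}.
  by have [_ /(_ l)[_ [_ /(_ k)[_ [Hc _]]]]] := Cf; exact: Hc.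
have e20 : 0 < e%:num / 2 by [].
have H0 : \forall y \near x, U y by exact: open_nbhs_nbhs.
have close k l : \forall y \near x,
    `|partial k (partial l f) x - partial k (partial l f) y| <= e%:num / 2.
  by have /cvgrPdist_le/(_ _ e20) := cij k l.
have : \forall y \near x, U y /\
   (`|partial i (partial j f) x - partial i (partial j f) y| <= e%:num / 2 /\
    `|partial j (partial i f) x - partial j (partial i f) y| <= e%:num / 2).
  by apply: filterI H0 _; apply: filterI (close i j) (close j i).
move=> /nbhs_ballP[d /= d0 xd].
pose s := d / 4.
have s0 : 0 < s by rewrite divr_gt0.
have Hy (y : 'cV[R]_m) : (forall k, `|y k 0| <= `|s| + `|s|) -> ball x d (y + x).
  move=> Hs; rewrite -ball_normE /= opprD addrCA subrr addr0 normrN.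
  apply: (@le_lt_trans _ _ (`|s| + `|s|)).
    by apply: mx_norm_le => [|k l]; rewrite ?addr_ge0 // ord1.
  by rewrite gtr0_norm // /s; lra.
have [y1 ys1 e1] := @second_difference U f x i j s Cf (fun y ys => (xd _ (Hy y ys)).1).
have [y2 ys2] := @second_difference U f x j i s Cf (fun y ys => (xd _ (Hy y ys)).1).
rewrite sub_interchange addrCA.
have [_ [H1 _]] := xd _ (Hy y1 ys1); have [_ [_ H2]] := xd _ (Hy y2 ys2).
move=> e2; apply: (dist_common (lt0r_neq0 s0) _ H1 H2); exact: etrans (esym e1) e2.
Qed.

Lemma smooth_derivable U f x v : open U -> smooth U f -> U x -> derivable f x v.
Proof. by move=> oU Sf Ux; apply: diff_derivable; exact: smooth_differentiable Sf Ux. Qed.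

(** The first order parts of the two compositions give the bracket; the second
    order parts cancel because partial derivatives commute. *)
Lemma along_bracket U X Y f x : open U -> smooth_mx U X -> smooth_mx U Y -> smooth U f -> U x ->
  along X (along Y f) x - along Y (along X f) x = along (bracket X Y) f x.
Proof.
move=> oU SX SY Sf Ux.
have H Z W : smooth_mx U Z -> smooth_mx U W -> along Z (along W f) x =
    \sum_i along Z (fun y => W y i 0) x * partial i f x
    + \sum_i \sum_j (W x i 0 * Z x j 0) * partial j (partial i f) x.
  move=> SZ SW; rewrite {1}/along.
  rewrite (derive_open_eq (g := \sum_i (fun y => W y i 0 * partial i f y)) _ oU Ux).
    rewrite derive_sum => [|i]; last first.
      by apply: (smooth_derivable (U := U) oU _ Ux); apply: smoothM => //; exact: smooth_partial.
    rewrite -big_split; apply: eq_bigr => i _ /=.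
    have dW : derivable (fun y => W y i 0) x (Z x) by apply: (smooth_derivable (U := U) oU _ Ux).
    have dp : derivable (partial i f) x (Z x).
      by apply: (smooth_derivable (U := U) oU _ Ux); exact: smooth_partial.
    rewrite [LHS](deriveM dW dp) [RHS]addrC; congr (_ + _); last exact: mulrC.
    rewrite derive_partials; last by apply: (smooth_differentiable oU _ Ux); exact: smooth_partial.
    by rewrite /GRing.scale /= mulr_sumr; apply: eq_bigr => j _; rewrite mulrA.
  move=> y Uy; rewrite /along derive_partials ?fct_sumE //; exact: smooth_differentiable Sf Uy.
rewrite !H // [X in _ + X - _]exchange_big /=.
rewrite [X in _ + X - _](eq_bigr (fun j => \sum_i (X x j 0 * Y x i 0) * partial i (partial j f) x)); last first.
  by move=> j _; apply: eq_bigr => i _; rewrite (partialC j i oU (Sf 2%N) Ux); congr (_ * _); rewrite mulrC.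
rewrite opprD addrACA subrr addr0 -sumrB.
rewrite /along derive_partials; last exact: smooth_differentiable Sf Ux.
by apply: eq_bigr => i _; rewrite mxE mulrBl.
Qed.

Lemma differentiable_cV p (F : 'cV[R]_m -> 'cV[R]_p) x :
  (forall i, differentiable (fun y => F y i 0) x) -> differentiable F x.
Proof.
move=> dF; rewrite (_ : F = \sum_i (fun y => F y i 0 *: delta_mx i 0)).
  by apply: differentiable_sum => i; apply: differentiableZl.
apply/funext => y; rewrite fct_sumE {1}(matrix_sum_delta (F y)).
by apply: eq_bigr => i _; rewrite big_ord1.
Qed.

Lemma derive_comp p (u : 'cV[R]_p -> R) (F : 'cV[R]_m -> 'cV[R]_p) x v :
  differentiable u (F x) -> (forall i, differentiable (fun y => F y i 0) x) ->
  derivable (fun y => u (F y)) x v /\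
  'D_v (fun y => u (F y)) x = \sum_i partial i u (F x) * 'D_v (fun y => F y i 0) x.
Proof.
move=> du /differentiable_cV dFx.
have dc : differentiable (u \o F) x by exact: differentiable_comp.
split; first exact: diff_derivable.
rewrite -[LHS]/('D_v (u \o F) x) deriveE // diff_comp //= -deriveE // -(deriveE v dFx) derive_partials //.
apply: eq_bigr => i _; rewrite mulrC derive_mx ?mxE //.
exact: diff_derivable.
Qed.

End SecondDerivatives.

(** * Derivations of a quaternionic triple *)

Section Quaternionic.
Context {R : realFieldType} {p : nat}.
Implicit Types J : 'M[R]_p.

Record quaternionic J1 J2 J3 : Prop := Quaternionic {
  quat11 : J1 *m J1 = - 1%:M; quat22 : J2 *m J2 = - 1%:M; quat33 : J3 *m J3 = - 1%:M;
  quat12 : J1 *m J2 = J3; quat21 : J2 *m J1 = - J3;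
  quat23 : J2 *m J3 = J1; quat32 : J3 *m J2 = - J1;
  quat31 : J3 *m J1 = J2; quat13 : J1 *m J3 = - J2 }.

Lemma quaternionic_cycle J1 J2 J3 : quaternionic J1 J2 J3 -> quaternionic J2 J3 J1.
Proof. by case. Qed.

Section QuaternionicDerivation.
Variables (J1 J2 J3 : 'M[R]_p) (B1 B2 B3 : 'cV[R]_p -> 'M[R]_p).
Hypothesis qJ : quaternionic J1 J2 J3.

(** What remains of B_i(X) = D_X J_i for a derivation D_X of the matrix algebra:
    the identities obtained by differentiating the quaternion relations. *)
Record quat_derivation : Prop := QuatDerivation {
  qder11 : forall X, B1 X *m J1 = - (J1 *m B1 X);
  qder22 : forall X, B2 X *m J2 = - (J2 *m B2 X);
  qder33 : forall X, B3 X *m J3 = - (J3 *m B3 X);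
  qder12 : forall X, B3 X = B1 X *m J2 + J1 *m B2 X;
  qder23 : forall X, B1 X = B2 X *m J3 + J2 *m B3 X;
  qder31 : forall X, B2 X = B3 X *m J1 + J3 *m B1 X;
  qder21 : forall X, - B3 X = B2 X *m J1 + J2 *m B1 X;
  qder32 : forall X, - B1 X = B3 X *m J2 + J3 *m B2 X;
  qder13 : forall X, - B2 X = B1 X *m J3 + J1 *m B3 X }.

Hypothesis dB : quat_derivation.
Hypothesis k1 : forall X, B1 (J1 *m X) = B1 X *m J1.
Hypothesis k2 : forall X, B2 (J2 *m X) = B2 X *m J2.
Hypothesis k3 : forall X, B3 (J3 *m X) = B3 X *m J3.
Hypothesis odd2 : forall X, B2 (- X) = - B2 X.

(** B_3 (J_3 X) is computed twice, as B_3 X J_3 and by expanding B_3 through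
    B_1 and B_2, with J_3 X = J_1 (J_2 X) = - J_2 (J_1 X). *)
Lemma quat_type_relation X : B3 X = B1 (J2 *m X) - J1 *m B3 (J1 *m X) + J2 *m B1 X.
Proof.
have [q11 q22 q33 q12 q21 q23 q32 q31 q13] := qJ.
have e3 := k3 X; rewrite (qder12 dB) in e3.
have j3 : J3 *m X = J1 *m (J2 *m X) by rewrite mulmxA q12.
have j3' : J3 *m X = - (J2 *m (J1 *m X)) by rewrite mulmxA q21 mulNmx opprK.
rewrite {1}j3 {1}j3' k1 odd2 k2 mulmxN in e3.
have {e3} : B3 X = B1 (J2 *m X) + J1 *m B2 (J1 *m X) *m J1.
  have : B3 X *m J3 *m - J3 = B3 X by rewrite -mulmxA mulmxN q33 opprK mulmx1.
  rewrite -e3 => <-; rewrite mulmxDl !mulmxN !mulNmx !opprK.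
  by rewrite -!mulmxA q23 q11 mulmxN mulmx1 opprK.
have := qder21 dB (J1 *m X); rewrite k1 => e.
have -> : J1 *m B2 (J1 *m X) *m J1 = J1 *m (- B3 (J1 *m X) - J2 *m (B1 X *m J1)).
  by rewrite e addrK mulmxA.
move=> ->; rewrite mulmxBr mulmxN -addrA; congr (_ + (_ + _)).
by rewrite (qder11 dB) !mulmxN opprK !mulmxA q12 q31.
Qed.
End QuaternionicDerivation.

Lemma quat_derivation_cycle J1 J2 J3 B1 B2 B3 :
  quat_derivation J1 J2 J3 B1 B2 B3 -> quat_derivation J2 J3 J1 B2 B3 B1.
Proof. by case. Qed.

Lemma double_inj (A B : 'M[R]_p) : A + A = B + B -> A = B.
Proof.
by move=> /matrixP e; apply/matrixP => i j; have := e i j; rewrite !mxE; lra.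
Qed.

(** The three cyclic instances of [quat_type_relation] are linear in the
    values u, v, w of the B_l at rotated vectors, which can be eliminated. *)
Lemma quat_elimination J1 J2 J3 (b1 b2 b3 u v w : 'M[R]_p) : quaternionic J1 J2 J3 ->
  b3 = u - J1 *m v + J2 *m b1 -> b1 = w - J2 *m u + J3 *m b2 ->
  b2 = v - J3 *m w + J1 *m b3 -> b3 = J2 *m b1 - J1 *m b2.
Proof.
move=> [q11 q22 q33 q12 q21 q23 q32 q31 q13] e1 e2 e3.
have {}e2 : J2 *m b1 = J2 *m w + u + J1 *m b2.
  by rewrite {1}e2 !mulmxDr mulmxN !mulmxA q22 q23 mulNmx mul1mx opprK.
have {}e3 : J1 *m b2 = J1 *m v + J2 *m w - b3.
  by rewrite {1}e3 !mulmxDr mulmxN !mulmxA q11 q13 !mulNmx mul1mx opprK.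
move: e1 e2 e3; move: (J2 *m b1) (J1 *m b2) (J1 *m v) (J2 *m w) => x y z t.
move=> /matrixP e1 /matrixP e2 /matrixP e3; apply/matrixP => a b.
by move: (e1 a b) (e2 a b) (e3 a b); rewrite !mxE; lra.
Qed.

(** The algebraic core of Hitchin's lemma (three closed Hermitian forms of an
    almost hyper-Hermitian structure force it to be parallel): the hypotheses
    B_l (J_l X) = B_l X J_l are what closedness of the three forms gives
    ([almost_kahler_type]), and B_2 = 0 says that J_2 is parallel; the other
    two cases follow by cyclic permutation. *)
Lemma quat_derivation_eq0 J1 J2 J3 B1 B2 B3 : quaternionic J1 J2 J3 ->
  quat_derivation J1 J2 J3 B1 B2 B3 ->
  (forall X, B1 (J1 *m X) = B1 X *m J1) ->
  (forall X, B2 (J2 *m X) = B2 X *m J2) ->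
  (forall X, B3 (J3 *m X) = B3 X *m J3) ->
  (forall X, B1 (- X) = - B1 X) -> (forall X, B2 (- X) = - B2 X) ->
  (forall X, B3 (- X) = - B3 X) ->
  forall X, B2 X = 0.
Proof.
move=> qJ dB k1 k2 k3 o1 o2 o3 X.
have qJ' := quaternionic_cycle qJ; have qJ'' := quaternionic_cycle qJ'.
have dB' := quat_derivation_cycle dB; have dB'' := quat_derivation_cycle dB'.
have e1 := quat_type_relation qJ dB k1 k2 k3 o2 X.
have e2 := quat_type_relation qJ' dB' k2 k3 k1 o3 X.
have e3 := quat_type_relation qJ'' dB'' k3 k1 k2 o1 X.
have E3 := quat_elimination qJ e1 e2 e3.
have E1 := quat_elimination qJ' e2 e3 e1.
have q33 := quat33 qJ.
(* twice B3 X is the anticommutator of J2 and B1 X, which commutes with J2 *)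
have comm : J2 *m B3 X = B3 X *m J2.
  have e : B3 X + B3 X = J2 *m B1 X + B1 X *m J2.
    by rewrite {1}E3 {1}(qder12 dB) [_ + J1 *m _]addrC subrKA.
  apply: double_inj.
  rewrite -mulmxDr -mulmxDl e mulmxDr mulmxDl mulmxA (quat22 qJ) -!mulmxA (quat22 qJ).
  by rewrite mulNmx mul1mx mulmxN mulmx1 addrC.
have h : J3 *m B2 X = 0.
  apply: double_inj; have e := qder32 dB X; rewrite -comm in e.
  rewrite addr0 -(subrKA (J2 *m B3 X)) -e -E1; exact: subrr.
by rewrite -[B2 X]opprK -[B2 X]mul1mx -mulNmx -q33 -mulmxA h mulmx0 oppr0.
Qed.

(** An almost Kaehler structure is quasi-Kaehler. With
    a(X;Y,Z) = H(Y, B(X) Z) and q(X;Y,Z) = a(JX;JY,Z), the cyclic identity at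
    (X,Y,Z), (X,JY,JZ), (JX,Y,JZ) and (JX,JY,Z) is a linear system whose only
    solution has q = - a. *)
Lemma almost_kahler_type (H J : 'M[R]_p) (B : 'cV[R]_p -> 'M[R]_p) :
  H \in unitmx -> J *m J = - 1%:M -> J^T *m H = - (H *m J) ->
  (forall X, B X *m J = - (J *m B X)) ->
  (forall X, (H *m B X)^T = - (H *m B X)) ->
  (forall X Y Z : 'cV[R]_p, (Y^T *m H *m B X *m Z) 0 0 + (Z^T *m H *m B Y *m X) 0 0
     + (X^T *m H *m B Z *m Y) 0 0 = 0) ->
  forall X, B (J *m X) = B X *m J.
Proof.
move=> uH JJ JH BJ skB cyc X.
pose a (X Y Z : 'cV[R]_p) := (Y^T *m H *m B X *m Z) 0 0.
have aJ W Y Z : a W (J *m Y) Z = a W Y (J *m Z).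
  have e : J^T *m H *m B W = H *m B W *m J.
    by rewrite JH mulNmx -!mulmxA BJ mulmxN.
  by rewrite /a trmx_mul !mulmxA -(mulmxA Y^T) -(mulmxA Y^T) e !mulmxA.
have aJJ W Y Z : a W (J *m Y) (J *m Z) = - a W Y Z.
  by rewrite aJ mulmxA JJ mulNmx mul1mx /a mulmxN mxE.
have askew W Y Z : a W Y Z = - a W Z Y.
  rewrite /a -!(mulmxA _ H (B W)).
  have -> : Y^T *m (H *m B W) *m Z = (Z^T *m (H *m B W)^T *m Y)^T.
    by move: (H *m B W) => M; rewrite 2!trmx_mul !trmxK mulmxA.
  by rewrite mxE skB mulmxN mulNmx mxE.
have a0 W Y Z : a W Y Z + a Y Z W + a Z W Y = 0 by exact: cyc.
have q W Y Z : a (J *m W) (J *m Y) Z = - a W Y Z.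
  have := a0 W Y Z; have := a0 W (J *m Y) (J *m Z).
  have := a0 (J *m W) Y (J *m Z); have := a0 (J *m W) (J *m Y) Z.
  rewrite !aJJ -[a (J *m W) Y (J *m Z)]aJ -[a (J *m Z) W (J *m Y)]aJ.
  by rewrite -[a (J *m Y) Z (J *m W)]aJ; lra.
have e : J *m B (J *m X) = B X.
  have : H *m (J *m B (J *m X)) = H *m B X.
    apply/matrixP => i j.
    have entry (M : 'M[R]_p) : M i j = ((delta_mx i 0 : 'cV_p)^T *m M *m (delta_mx j 0 : 'cV_p)) 0 0.
      by rewrite trmx_delta -rowE -colE !mxE.
    rewrite (entry (H *m B X)) (entry (_ *m (_ *m _))).
    have := q X (delta_mx i 0) (delta_mx j 0); rewrite /a trmx_mul -!mulmxA.
    by rewrite (mulmxA _ H) JH !mulNmx mulmxN mxE -!mulmxA => /oppr_inj.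
  by move=> /(congr1 (mulmx (invmx H))); rewrite !mulKmx.
by rewrite BJ -e !mulmxA JJ !mulNmx mul1mx opprK.
Qed.
End Quaternionic.

(** * From the commutators of curvature with J to the scalar curvature *)

Section Trace.
Context {R : realFieldType} {p : nat}.
Variables (H J1 J2 J3 : 'M[R]_p) (Rm : 'I_p -> 'I_p -> 'M[R]_p) (t : R).
Hypothesis symH : H^T = H.
Hypothesis uH : H \in unitmx.
Hypothesis qJ : quaternionic J1 J2 J3.
Hypothesis skew3 : (H *m J3)^T = - (H *m J3).
Hypothesis Rm_skew : forall a b, Rm a b = - Rm b a.
Hypothesis Rm_metric : forall a b, (Rm a b)^T *m H + H *m Rm a b = 0.
Hypothesis Rm_bianchi : forall l k a b, Rm a b l k + Rm b k l a + Rm k a l b = 0.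
Hypothesis Rm_J1 : forall a b, J1 *m Rm a b - Rm a b *m J1 =
  t *: ((H *m J2) a b *: J3 - (H *m J3) a b *: J2).
Hypothesis Rm_J3 : forall a b, J3 *m Rm a b - Rm a b *m J3 =
  t *: ((H *m J1) a b *: J2 - (H *m J2) a b *: J1).

Let G := invmx H.
Let GT : G^T = G. Proof. by rewrite /G trmx_inv symH. Qed.
Let GH : G *m H = 1%:M. Proof. exact: mulVmx. Qed.
Let HG : H *m G = 1%:M. Proof. exact: mulmxV. Qed.

Let skE (M : 'M[R]_p) i j : M^T = - M -> M i j = - M j i.
Proof. by move=> /matrixP/(_ j i); rewrite !mxE => ->; rewrite ?opprK. Qed.

Definition ricci_mx : 'M[R]_p := \matrix_(j, k) \sum_i Rm i j i k.

(** The trace of the identity for [J_1, R] against J_2: on the left, J_2 J_1 and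
    J_1 J_2 contribute equally, and on the right only tr (J_2 J_2) = - p
    survives. *)
Lemma mxtrace_quat_curvature a b : 2 * \tr (Rm a b *m J3) = - (p%:R * t * (H *m J3) a b).
Proof.
have [q11 q22 q33 q12 q21 q23 q32 q31 q13] := qJ.
have trJ1 : \tr J1 = 0.
  have e : \tr J1 = - \tr J1 by rewrite -{1}q23 mxtrace_mulC q32 raddfN.
  lra.
have := congr1 (fun M => \tr (M *m J2)) (Rm_J1 a b).
rewrite /= mulmxBl -scalemxAl mulmxBl -!scalemxAl mxtraceZ !(raddfB (@mxtrace R p)) /= !mxtraceZ.
rewrite -!mulmxA mxtrace_mulC -mulmxA q21 q12 mulmxN q32 q22 !(raddfN (@mxtrace R p)) /= trJ1 mxtrace1 => e.
by lra.
Qed.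

(** Skewness of R moves J_3 to the other side of R; moving it back costs the
    commutator, and what is left is a contraction of R, hence Ricci. *)
Lemma contraction_J_curvature a b : \sum_k (J3 *m Rm k a) k b =
  - (H *m J3 *m (ricci_mx *m G)^T) b a - 2 * t * (H *m J3) a b.
Proof.
have [q11 q22 q33 q12 q21 q23 q32 q31 q13] := qJ.
have RG k : (Rm k a *m G)^T = - (Rm k a *m G).
  have e := congr1 (fun M => G *m M *m G) (Rm_metric k a).
  rewrite /= mulmxDr mulmxDl mulmx0 mul0mx !mulmxA GH mul1mx -!mulmxA HG mulmx1 in e.
  by rewrite trmx_mul GT; apply/eqP; rewrite -addr_eq0 e.
have ric q : \sum_k (Rm k a *m G) q k = - (ricci_mx *m G) a q.
  rewrite mxE -sumrN.
  under [RHS]eq_bigr do rewrite mxE mulr_suml -sumrN.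
  rewrite exchange_big /=; apply: eq_bigr => k _.
  by rewrite (skE _ _ (RG k)) mxE -sumrN; under eq_bigr do rewrite -mulNr.
have E k : (J3 *m Rm k a) k b = (H *m J3 *m (Rm k a *m G)) b k
    - t * ((H *m J1) k a * (H *m J2 *m G) b k - (H *m J2) k a * (H *m J1 *m G) b k).
  have -> : J3 *m Rm k a = (H *m (Rm k a *m J3) *m G)^T.
    have sR : (Rm k a)^T *m H = - (H *m Rm k a) by apply/eqP; rewrite -addr_eq0 Rm_metric.
    have sJ : J3^T *m H = - (H *m J3) by rewrite -skew3 trmx_mul symH.
    rewrite !trmx_mul GT symH -!mulmxA sR !mulmxN (mulmxA _ H) sJ mulNmx mulmxN opprK.
    by rewrite !mulmxA GH mul1mx.
  have -> : Rm k a *m J3 = J3 *m Rm k a - t *: ((H *m J1) k a *: J2 - (H *m J2) k a *: J1).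
    by rewrite -Rm_J3 opprB addrC subrK.
  rewrite mxE mulmxBr mulmxBl -!scalemxAr mulmxBr -!scalemxAr -!scalemxAl mulmxBl -!scalemxAl.
  have entry (A B C : 'M[R]_p) x y : (A - t *: (x *: B - y *: C)) b k
      = A b k - t * (x * B b k - y * C b k) by rewrite !mxE.
  by rewrite entry !mulmxA.
rewrite (eq_bigr _ (fun k _ => E k)) sumrB -mulr_sumr sumrB; congr (_ - _).
  rewrite mxE -sumrN; under eq_bigr do rewrite mxE.
  rewrite exchange_big /=; apply: eq_bigr => q _; rewrite -mulr_sumr -mulrN; congr (_ * _).
  by rewrite ric [in RHS]mxE.
have prodG (A B : 'M[R]_p) : B *m A = - J3 -> 
   \sum_k (H *m A) k a * (H *m B *m G) b k = - (H *m J3) b a.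
  move=> BA; transitivity ((H *m B *m G *m (H *m A)) b a).
    by rewrite [RHS]mxE; apply: eq_bigr => k _; exact: mulrC.
  by rewrite -!mulmxA (mulmxA G) GH mul1mx BA mulmxN mxE.
rewrite prodG // (skE _ _ skew3).
have -> : \sum_k (H *m J2) k a * (H *m J1 *m G) b k = (H *m J3) b a.
  transitivity ((H *m J1 *m G *m (H *m J2)) b a).
    by rewrite [RHS]mxE; apply: eq_bigr => k _; exact: mulrC.
  by rewrite -!mulmxA (mulmxA G) GH mul1mx q12.
rewrite [(H *m J3) b a](skE _ _ skew3); ring.
Qed.

(** The Bianchi identity splits tr (R(a,b) J_3) into two contractions of the
    previous kind. With [mxtrace_quat_curvature] this determines the
    difference of the matrix Q and its transpose as a multiple of P_3 = H J_3,
    and its trace against the inverse of P_3 is twice the scalar curvature. *)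
Lemma scalar_curvature_mx :
  4 * \sum_j \sum_k G j k * \sum_i Rm i j i k = t * p%:R * (p%:R + 8).
Proof.
have [q11 q22 q33 q12 q21 q23 q32 q31 q13] := qJ.
pose Q := H *m J3 *m (ricci_mx *m G)^T.
have trE a b : \tr (Rm a b *m J3) = - Q a b + Q b a + 4 * t * (H *m J3) a b.
  have -> : \tr (Rm a b *m J3) = \sum_k (J3 *m Rm k b) k a - \sum_k (J3 *m Rm k a) k b.
    rewrite mxtrace_mulC /mxtrace -sumrB; apply: eq_bigr => k _; rewrite !mxE -sumrB.
    apply: eq_bigr => l _; rewrite -mulrBr; congr (_ * _).
    have := Rm_bianchi l k a b; rewrite (Rm_skew b k) mxE.
    have lin (x y z : R) : x - y + z = 0 -> x = y - z by lra.
    exact: lin.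
  rewrite !contraction_J_curvature -/Q.
  rewrite (skE b a skew3); ring.
have eqQ : Q + Q - (Q^T + Q^T) = (t * (p%:R + 8)) *: (H *m J3).
  apply/matrixP => a b; have e := mxtrace_quat_curvature a b; rewrite trE in e.
  have entry (A B : 'M[R]_p) : (A + A - (B + B)) a b = A a b + A a b - (B a b + B a b) by rewrite !mxE.
  rewrite entry [Q^T a b]mxE [RHS]mxE; lra.
(* - (J3 *m G) is the inverse of P_3 = H *m J3 *)
have trI : \tr (H *m J3 *m - (J3 *m G)) = p%:R.
  by rewrite mulmxN -mulmxA (mulmxA J3) q33 mulNmx mul1mx mulmxN opprK HG mxtrace1.
have trQ : \tr (Q *m - (J3 *m G)) = \tr (ricci_mx *m G).
  rewrite mxtrace_mulC /Q mulNmx -!mulmxA (mulmxA G) GH mul1mx (mulmxA J3) q33 mulNmx mul1mx opprK.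
  exact: mxtrace_tr.
have trQT : \tr (Q^T *m - (J3 *m G)) = - \tr (ricci_mx *m G).
  rewrite /Q trmx_mul trmxK skew3 !mulmxN !mulNmx opprK.
  rewrite -!mulmxA (mulmxA J3) q33 mulNmx mul1mx !mulmxN HG mulmx1.
  exact: (raddfN (@mxtrace R p)).
have := congr1 (fun M => \tr (M *m - (J3 *m G))) eqQ.
rewrite /= mulmxBl !mulmxDl -scalemxAl mxtraceZ raddfB /= !mxtraceD trI trQ trQT.
have -> : \sum_j \sum_k G j k * \sum_i Rm i j i k = \tr (ricci_mx *m G).
  rewrite /mxtrace; apply: eq_bigr => j _; rewrite mxE; apply: eq_bigr => k _.
  by rewrite !mxE mulrC -[in LHS]GT mxE.
by lra.
Qed.
End Trace.

(** * Even triples of indices *)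

Section EvenTriples.
Implicit Types i j k l : 'I_3.

Let rot : 'S_3 := mulg (tperm 0 1) (tperm 0 2%:R).

Lemma rotE : [/\ rot 0 = 1, rot 1 = 2%:R & rot 2%:R = 0].
Proof. by split; rewrite permM; do 2?[case: tpermP => //]. Qed.

Lemma even_triple_cycle i j k : even_triple i j k -> even_triple j k i.
Proof.
move=> [s es [-> -> ->]]; exists (rot * s)%g.
  by rewrite !odd_permM !odd_tperm.
by have [r0 r1 r2] := rotE; split; rewrite permM; apply: (congr1 s); apply: esym.
Qed.

Lemma even_triple012 : even_triple 0 1 2%:R.
Proof. by exists (1%g : 'S_3); rewrite ?odd_perm1 // !perm1. Qed.

Lemma ord3P l : [\/ l = 0, l = 1 | l = 2%:R].
Proof. by case: l => [[|[|[|//]]]] ?; [constructor 1|constructor 2|constructor 3]; apply/val_inj. Qed.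

Lemma even_triple_cover i j k l : even_triple i j k -> [\/ l = i, l = j | l = k].
Proof.
move=> [s _ [-> -> ->]]; rewrite -(permKV s l).
by have [->|->|->] := ord3P (s^-1%g l); [constructor 1|constructor 2|constructor 3].
Qed.

Lemma even_triple_first l : exists j k, even_triple l j k.
Proof.
have e := even_triple012; have e' := even_triple_cycle e; have e'' := even_triple_cycle e'.
by have [->|->|->] := ord3P l; do 2 eexists; eassumption.
Qed.

Lemma even_triple_eqF i j k : even_triple i j k ->
  ((i == j) = false) * ((j == i) = false) * ((j == k) = false) *
  ((k == j) = false) * ((k == i) = false) * ((i == k) = false).
Proof. by move=> [s _ [-> -> ->]]; rewrite !(inj_eq perm_inj). Qed.

Lemma sum_even_triple (W : nmodType) (f : 'I_3 -> W) i j k : even_triple i j k ->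
  \sum_l f l = f i + f j + f k.
Proof.
move=> [s _ [-> -> ->]]; rewrite (reindex_inj (@perm_inj _ s)).
rewrite !big_ord_recl big_ord0 /= addr0 addrA; congr (f (s _) + f (s _) + f (s _)); exact/val_inj.
Qed.
End EvenTriples.

(** * Pointwise algebra of almost 3-contact metric structures *)

Section ContactAlgebra.
Context {R : realType} {m : nat}.
Variables (phi : 'I_3 -> 'M[R]_m) (xi : 'I_3 -> 'cV[R]_m) (eta : 'I_3 -> 'rV[R]_m) (g : 'M[R]_m).

(** The values at one point of an almost 3-contact metric structure. *)
Record contact3 : Prop := Contact3 {
  c3_sym : g^T = g;
  c3_sqr : forall i, phi i *m phi i = - 1%:M + xi i *m eta i;
  c3_norm : forall i, pairing (eta i) (xi i) = 1;
  c3_phi_xi : forall i, phi i *m xi i = 0;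
  c3_eta_phi : forall i, eta i *m phi i = 0;
  c3_metric : forall i u v, bilin g (phi i *m u) (phi i *m v) =
     bilin g u v - pairing (eta i) u * pairing (eta i) v;
  c3_phi : forall i j k, even_triple i j k -> phi k = phi i *m phi j - xi i *m eta j /\
     phi k = - (phi j *m phi i) + xi j *m eta i;
  c3_xi : forall i j k, even_triple i j k -> xi k = phi i *m xi j /\ xi k = - (phi j *m xi i);
  c3_eta : forall i j k, even_triple i j k -> eta k = eta i *m phi j /\ eta k = - (eta j *m phi i) }.

Hypothesis c3 : contact3.

Lemma pairing_mx (w : 'rV[R]_m) (v : 'cV[R]_m) : w *m v = (pairing w v)%:M.
Proof. by apply/matrixP => i j; rewrite !ord1 [RHS]mxE mulr1n. Qed.

Lemma pairing_eta_xi i j : pairing (eta i) (xi j) = (i == j)%:R.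
Proof.
have [->|ne] := eqVneq i j; first exact: c3_norm.
have [k [l e]] := even_triple_first i.
have e' := even_triple_cycle e; have e'' := even_triple_cycle e'.
have [ji|->|->] := even_triple_cover j e; first by rewrite ji eqxx in ne.
  by rewrite (c3_eta c3 e').2 /pairing mulNmx -mulmxA c3_phi_xi // mulmx0 oppr0 mxE.
by rewrite (c3_eta c3 e').1 /pairing -mulmxA c3_phi_xi // mulmx0 mxE.
Qed.

Lemma bilin_xi i u : bilin g u (xi i) = pairing (eta i) u.
Proof.
have := c3_metric c3 i u (xi i); rewrite (c3_norm c3) mulr1 (c3_phi_xi c3).
by rewrite {1}/bilin mulmx0 mxE => /esym/eqP; rewrite subr_eq0 => /eqP.
Qed.

Lemma bilin_entry (M : 'M[R]_m) i j : bilin M (delta_mx i 0) (delta_mx j 0) = M i j.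
Proof. by rewrite /bilin trmx_delta -rowE -colE !mxE. Qed.

Lemma bilin_sym u v : bilin g u v = bilin g v u.
Proof.
rewrite /bilin; have -> : v^T *m g *m u = (u^T *m g *m v)^T.
  by rewrite !trmx_mul trmxK c3_sym // mulmxA.
by rewrite [RHS]mxE.
Qed.

Lemma bilin_phi_skew i u v : bilin g u (phi i *m v) = - bilin g (phi i *m u) v.
Proof.
have e0 w : pairing (eta i) (phi i *m w) = 0.
  by rewrite /pairing mulmxA (c3_eta_phi c3) mul0mx mxE.
have := c3_metric c3 i u (phi i *m v); rewrite e0 mulr0 subr0 => <-.
rewrite mulmxA (c3_sqr c3) mulmxDl mulNmx mul1mx -mulmxA pairing_mx mul_mx_scalar.
rewrite /bilin mulmxDr mulmxN -scalemxAr.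
rewrite [LHS]mxE [X in X + _]mxE [X in _ + X]mxE.
by rewrite -[X in _ + _ * X]/(bilin g (phi i *m u) (xi i)) bilin_xi e0 mulr0 addr0.
Qed.

Lemma metric_phi_skew i : (g *m phi i)^T = - (g *m phi i).
Proof.
apply/matrixP => a b; rewrite [LHS]mxE -!bilin_entry.
have E u v : bilin (g *m phi i) u v = bilin g u (phi i *m v) by rewrite /bilin !mulmxA.
have -> : bilin (- (g *m phi i)) (delta_mx a 0) (delta_mx b 0) = - bilin (g *m phi i) (delta_mx a 0) (delta_mx b 0).
  by rewrite /bilin mulmxN mulNmx mxE.
by rewrite !E bilin_phi_skew bilin_sym.
Qed.

Variables (p : nat) (T : 'M[R]_(p, m)) (E : 'M[R]_(m, p)).
Hypothesis kerT : forall v : 'cV[R]_m, T *m v = 0 <-> exists b : 'I_3 -> R, v = \sum_i b i *: xi i.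
Hypothesis TE : T *m E = 1%:M.
Hypothesis etaE : forall i, eta i *m E = 0.

Lemma vertical_decomposition v : T *m v = 0 -> v = \sum_i pairing (eta i) v *: xi i.
Proof.
move=> /kerT[b vE]; rewrite {1}vE; apply: eq_bigr => i _; congr (_ *: _).
rewrite vE /pairing mulmx_sumr summxE (bigD1 i) //= -scalemxAr mxE -/(pairing _ _).
rewrite pairing_eta_xi eqxx mulr1 big1 ?addr0 // => j ji.
by rewrite -scalemxAr mxE -/(pairing _ _) pairing_eta_xi eq_sym (negbTE ji) mulr0.
Qed.

(** A tangent vector is determined by its projection to the base and by its
    components along the Reeb fields. *)
Lemma horizontal_eq n (A B : 'M[R]_(m, n)) : T *m A = T *m B ->
  (forall i, eta i *m A = eta i *m B) -> A = B.
Proof.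
move=> TAB eAB; apply/eqP; rewrite -subr_eq0; apply/eqP/matrixP => a b.
have : col b (A - B) = 0.
  rewrite (@vertical_decomposition (col b (A - B))); last first.
    by rewrite colE mulmxA mulmxBr TAB subrr mul0mx.
  apply: big1 => i _; by rewrite /pairing colE mulmxA mulmxBr eAB subrr mul0mx mxE scale0r.
by move=> /matrixP/(_ a 0); rewrite !mxE.
Qed.

Lemma T_xi i : T *m xi i = 0.
Proof.
apply/kerT; exists (fun j => (j == i)%:R); rewrite (bigD1 i) //= eqxx scale1r big1 ?addr0 // => j ji.
by rewrite (negbTE ji) scale0r.
Qed.

(** phi_j preserves horizontality: eta_i phi_j is zero or, up to sign, the
    third eta. *)
Lemma eta_phi_E i j : eta i *m (phi j *m E) = 0.
Proof.
have [k [l e]] := even_triple_first i.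
have e' := even_triple_cycle e; have e'' := even_triple_cycle e'.
rewrite mulmxA; have [->|->|->] := even_triple_cover j e.
- by rewrite (c3_eta_phi c3) mul0mx.
- by rewrite -(c3_eta c3 e).1 etaE.
by rewrite -[eta i *m _]opprK -(c3_eta c3 e'').2 mulNmx etaE oppr0.
Qed.

(** The endomorphism induced by phi_i on the horizontal space, in the basis of
    the lifts (the columns of E) of the coordinate vectors of the base. *)
Definition baseJ i := T *m phi i *m E.

Lemma phi_E i : phi i *m E = E *m baseJ i.
Proof.
apply: horizontal_eq => [|j]; first by rewrite /baseJ !mulmxA TE mul1mx.
by rewrite eta_phi_E mulmxA etaE mul0mx.
Qed.

Lemma baseJ_sqr i : baseJ i *m baseJ i = - 1%:M.
Proof.
rewrite {1}/baseJ -!mulmxA -phi_E (mulmxA (phi i)) (c3_sqr c3) mulmxDl -mulmxA etaE mulmx0 addr0.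
by rewrite mulNmx mul1mx mulmxN TE.
Qed.

Lemma baseJ_mul i j k : even_triple i j k ->
  baseJ i *m baseJ j = baseJ k /\ baseJ j *m baseJ i = - baseJ k.
Proof.
move=> e; have [e1 e2] := c3_phi c3 e; split.
  rewrite {1}/baseJ -!mulmxA -phi_E (mulmxA (phi i)) -[phi i *m phi j](subrK (xi i *m eta j)) -e1.
  by rewrite mulmxDl -[xi i *m _ *m _]mulmxA etaE mulmx0 addr0 !mulmxA.
rewrite {1}/baseJ -!mulmxA -phi_E (mulmxA (phi j)).
have -> : phi j *m phi i = - phi k + xi j *m eta i by rewrite e2 opprD opprK addrNK.
by rewrite mulmxDl -[xi j *m _ *m _]mulmxA etaE mulmx0 addr0 mulNmx mulmxN !mulmxA.
Qed.

Lemma baseJ_quaternionic i j k : even_triple i j k ->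
  quaternionic (baseJ i) (baseJ j) (baseJ k).
Proof.
move=> e; have e' := even_triple_cycle e; have e'' := even_triple_cycle e'.
have [a b] := baseJ_mul e; have [a' b'] := baseJ_mul e'; have [a'' b''] := baseJ_mul e''.
by split=> //; exact: baseJ_sqr.
Qed.

Lemma baseP_skew i : (E^T *m g *m phi i *m E)^T = - (E^T *m g *m phi i *m E).
Proof.
by rewrite -!mulmxA trmx_mul trmxK (mulmxA g) trmx_mul metric_phi_skew mulmxN mulNmx !mulmxA.
Qed.

Lemma bilin_xi_phi_E i j (u : 'cV[R]_p) : bilin g (xi i) (phi j *m (E *m u)) = 0.
Proof.
by rewrite bilin_sym bilin_xi /pairing !mulmxA -(mulmxA _ _ E) eta_phi_E mul0mx mxE.
Qed.
End ContactAlgebra.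

(** * Horizontal lifts *)

Section HorizontalLift.
Context {R : realType} {p : nat}.
Variables (T : 'M[R]_(p, p + 3)) (eta : 'I_3 -> 'rV[R]_(p + 3)).

Definition frame_mx : 'M[R]_(p + 3) := col_mx T (\matrix_(i < 3) eta i).
(** Inverting the square matrix with rows T and eta yields the dual frame: its
    first p columns are the horizontal lifts, the other three the xi_i. This
    makes the lifts smooth without a choice. *)
Definition hlift : 'M[R]_(p + 3, p) := lsubmx (invmx frame_mx).

Lemma unitmx_inj (k : nat) (A : 'M[R]_k) : (forall v : 'cV[R]_k, A *m v = 0 -> v = 0) -> A \in unitmx.
Proof.
move=> inj; rewrite -unitmx_tr -row_free_unit -kermx_eq0.
apply/eqP/row_matrixP => i; rewrite row0.
apply: trmx_inj; rewrite linear0; apply: inj.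
by rewrite -{1}[A]trmxK -trmx_mul -row_mul mulmx_ker row0 linear0.
Qed.

Lemma frame_mx_unit (xi : 'I_3 -> 'cV[R]_(p + 3)) :
  (forall v : 'cV[R]_(p + 3), T *m v = 0 -> v = \sum_i pairing (eta i) v *: xi i) ->
  frame_mx \in unitmx.
Proof.
move=> dec; apply: unitmx_inj => v; rewrite mul_col_mx => /eqP.
rewrite col_mx_eq0 => /andP[/eqP Tv /eqP Nv].
rewrite (dec v Tv) big1 // => i _; have : row i (\matrix_(i < 3) eta i *m v) = 0 by rewrite Nv row0.
by rewrite row_mul rowK /pairing => ->; rewrite mxE scale0r.
Qed.

Lemma frame_hlift : frame_mx \in unitmx -> T *m hlift = 1%:M /\ forall i, eta i *m hlift = 0.
Proof.
move=> uA; have : frame_mx *m hlift = col_mx 1%:M 0.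
  rewrite /hlift mulmx_lsub mulmxV // scalar_mx_block block_mxEh row_mxKl //.
rewrite mul_col_mx => /eq_col_mx[T1 N0]; split=> // i.
by rewrite -(rowK eta i) -row_mul N0 row0.
Qed.
End HorizontalLift.

(** * Directional derivatives of matrix-valued functions *)

Section MatrixDerivative.
Context {R : realType} {m : nat}.
Implicit Types (U : set 'cV[R]_m).

Definition derive_entries {p q : nat} (v : 'cV[R]_m) (A : 'cV[R]_m -> 'M[R]_(p, q)) x : 'M[R]_(p, q) :=
  \matrix_(i, j) 'D_v (fun y => A y i j) x.

Lemma derive_entries_eq p q U v (A B : 'cV[R]_m -> 'M[R]_(p, q)) x : open U -> U x ->
  (forall y, U y -> A y = B y) -> derive_entries v A x = derive_entries v B x.
Proof.
move=> oU Ux AB; apply/matrixP => i j; rewrite !mxE; apply: (derive_open_eq v oU Ux) => y Uy.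
by rewrite AB.
Qed.

Definition derivable_entries {p q : nat} (v : 'cV[R]_m) (A : 'cV[R]_m -> 'M[R]_(p, q)) x :=
  forall i j, derivable (fun y => A y i j) x v.

Lemma smooth_derivable_entries p q U v (A : 'cV[R]_m -> 'M[R]_(p, q)) x :
  open U -> smooth_mx U A -> U x -> derivable_entries v A x.
Proof. by move=> oU SA Ux i j; exact: smooth_derivable oU (SA i j) Ux. Qed.

Lemma derivable_entriesM p q r v (A : 'cV[R]_m -> 'M[R]_(p, q)) (B : 'cV[R]_m -> 'M[R]_(q, r)) x :
  derivable_entries v A x -> derivable_entries v B x ->
  derivable_entries v (fun y => A y *m B y) x /\
  derive_entries v (fun y => A y *m B y) x =
  derive_entries v A x *m B x + A x *m derive_entries v B x.
Proof.
move=> dA dB.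
have E i j : (fun y => (A y *m B y) i j) = \sum_k (fun y => A y i k * B y k j).
  by apply/funext => y; rewrite fct_sumE mxE.
have dAB i j k : derivable (fun y => A y i k * B y k j) x v by exact: derivableM.
split=> [i j|]; first by rewrite E; exact: derivable_sum.
apply/matrixP => i j; rewrite !mxE -big_split /= E derive_sum //.
apply: eq_bigr => k _; rewrite [LHS](deriveM (dA i k) (dB k j)) !mxE addrC; congr (_ + _).
exact: mulrC.
Qed.

Lemma derive_entriesM p q r U v (A : 'cV[R]_m -> 'M[R]_(p, q)) (B : 'cV[R]_m -> 'M[R]_(q, r)) x :
  open U -> U x -> smooth_mx U A -> smooth_mx U B ->
  derive_entries v (fun y => A y *m B y) x =
  derive_entries v A x *m B x + A x *m derive_entries v B x.
Proof.
move=> oU Ux SA SB.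
have [_] := @derivable_entriesM p q r v A B x (smooth_derivable_entries oU SA Ux) (smooth_derivable_entries oU SB Ux); exact.
Qed.

Lemma derivable_entriesT p q v (A : 'cV[R]_m -> 'M[R]_(p, q)) x :
  derivable_entries v A x -> derivable_entries v (fun y => (A y)^T) x.
Proof.
move=> dA i j; have -> : (fun y => (A y)^T i j) = (fun y => A y j i) by apply/funext => y; rewrite mxE.
exact: dA.
Qed.

Lemma derive_entriesT p q v (A : 'cV[R]_m -> 'M[R]_(p, q)) x :
  derive_entries v (fun y => (A y)^T) x = (derive_entries v A x)^T.
Proof.
by apply/matrixP => i j; rewrite !mxE; congr ('D_v _ x); apply/funext => y; rewrite mxE.
Qed.

Lemma derive_entriesN p q v (A : 'cV[R]_m -> 'M[R]_(p, q)) x : derivable_entries v A x ->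
  derive_entries v (fun y => - A y) x = - derive_entries v A x.
Proof.
move=> dA; apply/matrixP => i j; rewrite !mxE.
have -> : (fun y => (- A y) i j) = - (fun y => A y i j) by apply/funext => y; rewrite !mxE.
by rewrite deriveN.
Qed.

Lemma derive_entriesD p q v (A B : 'cV[R]_m -> 'M[R]_(p, q)) x :
  derivable_entries v A x -> derivable_entries v B x ->
  derive_entries v (fun y => A y + B y) x = derive_entries v A x + derive_entries v B x.
Proof.
move=> dA dB; apply/matrixP => i j; rewrite !mxE.
have -> : (fun y => (A y + B y) i j) = (fun y => A y i j) + (fun y => B y i j) by apply/funext => y; rewrite !mxE.
by rewrite deriveD.
Qed.

Lemma derive_entries_cst p q v (A : 'M[R]_(p, q)) x : derive_entries v (fun=> A) x = 0.
Proof. by apply/matrixP => i j; rewrite !mxE; exact: derive_cst. Qed.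
End MatrixDerivative.

(** * The Levi-Civita connection in coordinates *)

Lemma bianchi_identity (R : realType) (p : nat) (D : 'I_p -> 'I_p -> 'I_p -> 'I_p -> R)
    (Gm : 'I_p -> 'I_p -> 'I_p -> R) (l k a b : 'I_p) :
  (forall c d e f, D c d e f = D c d f e) -> (forall d e f, Gm d e f = Gm d f e) ->
  (D a l b k - D b l a k + \sum_q (Gm l a q * Gm q b k - Gm l b q * Gm q a k)) +
  (D b l k a - D k l b a + \sum_q (Gm l b q * Gm q k a - Gm l k q * Gm q b a)) +
  (D k l a b - D a l k b + \sum_q (Gm l k q * Gm q a b - Gm l a q * Gm q k b)) = 0.
Proof.
move=> E S; rewrite !sumrB (E a l b k) (E b l a k) (E k l a b).
have T c d e : \sum_q Gm l c q * Gm q d e = \sum_q Gm l c q * Gm q e d.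
  by apply: eq_bigr => q _; rewrite (S q d e).
rewrite (T a b k) (T b a k) (T k a b); ring.
Qed.

Section LeviCivita.
Context {R : realType} {p : nat}.
Variables (V : set 'cV[R]_p) (h : 'cV[R]_p -> 'M[R]_p).
Hypothesis oV : open V.
Hypothesis Sh : smooth_mx V h.
Hypothesis symh : forall y, V y -> (h y)^T = h y.
Hypothesis unith : forall y, V y -> h y \in unitmx.

Definition christoffel_mx (c : 'I_p) y : 'M[R]_p := \matrix_(d, a) christoffel h d c a y.

Definition riemann_mx (a b : 'I_p) y : 'M[R]_p := \matrix_(l, k) riemann h l k a b y.

Lemma partial_metric_sym c a b y : V y ->
  partial c (fun z => h z a b) y = partial c (fun z => h z b a) y.
Proof.
move=> Vy; apply: (derive_open_eq _ oV Vy) => z Vz.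
by rewrite -[in LHS]symh // mxE.
Qed.

Lemma christoffel_sym l a b y : V y -> christoffel h l a b y = christoffel h l b a y.
Proof.
move=> Vy; rewrite /christoffel; congr (_ * _); apply: eq_bigr => d _; congr (_ * _).
by rewrite [partial a _ _ + _]addrC (partial_metric_sym d a b Vy).
Qed.

(** Lowering the upper index cancels the inverse metric in the definition of
    the Christoffel symbols. *)
Lemma christoffel_lowered c a b y : V y ->
  (h y *m christoffel_mx c y) a b = 2^-1 *
    (partial c (fun z => h z b a) y + partial b (fun z => h z c a) y - partial a (fun z => h z c b) y).
Proof.
move=> Vy; pose w := \col_l (partial c (fun z => h z b l) y + partial b (fun z => h z c l) y
   - partial l (fun z => h z c b) y).
have -> : (h y *m christoffel_mx c y) a b = (h y *m (2^-1 *: (invmx (h y) *m w))) a 0.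
  rewrite !mxE; apply: eq_bigr => d _; congr (_ * _); rewrite !mxE /christoffel.
  by congr (_ * _); apply: eq_bigr => l _; rewrite mxE.
by rewrite -scalemxAr mulKVmx ?unith // !mxE.
Qed.

Lemma christoffel_metric c a b y : V y ->
  partial c (fun z => h z a b) y =
  ((christoffel_mx c y)^T *m h y + h y *m christoffel_mx c y) a b.
Proof.
move=> Vy; rewrite [RHS]mxE -{1}(symh Vy) -trmx_mul [X in X + _]mxE !christoffel_lowered //.
rewrite (partial_metric_sym c b a Vy); lra.
Qed.

Lemma smooth_christoffel l a b : smooth V (christoffel h l a b).
Proof.
apply: smoothM => //; first exact: smooth_cst.
apply: smooth_sum => // d; apply: smoothM => //.
  exact: (smooth_invmx oV unith Sh).
by apply: smoothB => //; [apply: smoothD => //|]; apply: smooth_partial.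
Qed.

Lemma riemann_bianchi l k a b y : V y ->
  riemann_mx a b y l k + riemann_mx b k y l a + riemann_mx k a y l b = 0.
Proof.
move=> Vy; rewrite /riemann_mx [X in X + _ + _]mxE [X in _ + X + _]mxE [X in _ + X]mxE.
apply: (bianchi_identity (D := fun c l a b => partial c (christoffel h l a b) y)
   (Gm := fun l a b => christoffel h l a b y)) => [c d e f|d e f].
  by apply: (derive_open_eq _ oV Vy) => z Vz; exact: christoffel_sym.
exact: christoffel_sym.
Qed.

Lemma riemann_mx_skew a b y : riemann_mx a b y = - riemann_mx b a y.
Proof.
apply/matrixP => l k; rewrite !mxE /riemann opprD opprB -sumrN; congr (_ + _).
by apply: eq_bigr => q _; rewrite opprB.
Qed.

Lemma riemann_mxE a b y : riemann_mx a b y =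
  derive_entries (delta_mx a 0) (christoffel_mx b) y - derive_entries (delta_mx b 0) (christoffel_mx a) y
  + (christoffel_mx a y *m christoffel_mx b y - christoffel_mx b y *m christoffel_mx a y).
Proof.
apply/matrixP => l k; rewrite !mxE /riemann -sumrB; congr (_ + _).
  congr (_ - _); rewrite /partial; apply: (congr1 (fun f => 'D_ _ f y)); apply/funext => z; by rewrite mxE.
by apply: eq_bigr => q _; rewrite !mxE.
Qed.
End LeviCivita.

(** * Leibniz rules and tensoriality of the exterior derivative *)

Section SmoothRules.
Context {R : realType} {m : nat}.
Implicit Types (U : set 'cV[R]_m) (X Y : 'cV[R]_m -> 'cV[R]_m) (w : 'cV[R]_m -> 'rV[R]_m).

Lemma along_pairing U X w Y x : open U -> U x -> smooth_mx U w -> smooth_mx U Y ->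
  along X (fun y => pairing (w y) (Y y)) x =
  pairing (derive_entries (X x) w x) (Y x) + pairing (w x) (derive_entries (X x) Y x).
Proof.
move=> oU Ux Sw SY; have /matrixP/(_ 0 0) := derive_entriesM (X x) oU Ux Sw SY.
by rewrite mxE [RHS]mxE.
Qed.

(** Reduces d w to constant vector fields, so that a structure equation known
    only for fields on a whole chart can be used for frames on a smaller open
    set. *)
Lemma ext_d_tensorial U w X Y x : open U -> U x -> smooth_mx U w -> smooth_mx U X ->
  smooth_mx U Y -> ext_d w X Y x = ext_d w (fun=> X x) (fun=> Y x) x.
Proof.
move=> oU Ux Sw SX SY; have Sc (v : 'cV[R]_m) : smooth_mx U (fun=> v) by move=> i j; exact: smooth_cst.
rewrite /ext_d (along_pairing X oU Ux Sw SY) (along_pairing Y oU Ux Sw SX).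
rewrite (along_pairing (fun=> X x) oU Ux Sw (Sc (Y x))) (along_pairing (fun=> Y x) oU Ux Sw (Sc (X x))).
have brE X' Y' : bracket X' Y' x = derive_entries (X' x) Y' x - derive_entries (Y' x) X' x.
  by apply/matrixP => i j; rewrite !mxE ord1.
rewrite !brE !derive_entries_cst subrr linear0 linearB /=; ring.
Qed.

Lemma derive_sumZ (I : finType) (c : I -> R) (v : I -> 'cV[R]_m) (f : 'cV[R]_m -> R) x :
  differentiable f x -> 'D_(\sum_l c l *: v l) f x = \sum_l c l * 'D_(v l) f x.
Proof.
move=> df; rewrite deriveE // linear_sum; apply: eq_bigr => l _.
by rewrite linearZ deriveE.
Qed.

Lemma derive_sum_mul U (c : R) (A B : 'I_3 -> 'cV[R]_m -> R) v x : open U -> U x ->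
  (forall l, smooth U (A l)) -> (forall l, smooth U (B l)) ->
  'D_v (fun y => c * \sum_l (A l y * B l y)) x =
  c * \sum_l ('D_v (A l) x * B l x + A l x * 'D_v (B l) x).
Proof.
move=> oU Ux SA SB.
have dA l : derivable (A l) x v by exact: smooth_derivable oU (SA l) Ux.
have dB l : derivable (B l) x v by exact: smooth_derivable oU (SB l) Ux.
have -> : (fun y => c * \sum_l (A l y * B l y)) = c *: (\sum_l (fun y => A l y * B l y)).
  by apply/funext => y; rewrite /= fctE fct_sumE.
have dAB l : derivable (fun y => A l y * B l y) x v by exact: derivableM.
rewrite deriveZ; last exact: derivable_sum.
rewrite derive_sum //; congr (_ * _); apply: eq_bigr => l _.
by rewrite [LHS](deriveM (dA l) (dB l)) addrC; congr (_ + _); exact: mulrC.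
Qed.
End SmoothRules.

(** * Jacobi identities for the lifted frame *)

Lemma jacobi_sum (R : idomainType) (I : Type) (N S : I -> I -> I -> R) (k : R) : k != 0 ->
  (forall c a b, N c a b - N c b a - (N a b c - N b a c) = k * S c a b) ->
  forall c a b, S c a b + S a b c + S b c a = 0.
Proof.
move=> k0 e c a b; apply: (mulfI k0); rewrite mulr0 !mulrDr -!e; ring.
Qed.

(** The Jacobi identity for xi_i and two lifts, with X, Y, Z the derivatives of
    a function along the three Reeb fields: after the second order terms
    cancel, it is linear in X, Y, Z with these coefficients. *)
Lemma xi_coefficients (R : comRingType) (p1 p2 p3 P1 P2 P3 X Y Z ii ij ik ji ki c : R) :
  ki - ik = c * Y -> ij - ji = c * Z ->
  p1 * X + P1 * ii + (p2 * Y + P2 * ij) + (p3 * Z + P3 * ik) = P1 * ii + P2 * ji + P3 * ki ->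
  (p1 - 0) * X + (p2 - c * P3) * Y + (p3 - - (c * P2)) * Z = 0.
Proof.
move=> e1 e2 /eqP; rewrite -subr_eq0 => /eqP e3.
have {}e1 : ki = ik + c * Y by rewrite -e1 addrC subrK.
have {}e2 : ij = ji + c * Z by rewrite -e2 addrC subrK.
by rewrite -[RHS]e3 e1 e2; ring.
Qed.

(** The frame enters only through its brackets. All identities are tested on
    smooth functions, on which brackets act as commutators, and the xi_l are
    independent as operators on functions ([xi_free]). *)
Section JacobiIdentities.
Context {R : realType} {m p : nat}.
Variables (U : set 'cV[R]_m) (Ec : 'I_p -> 'cV[R]_m -> 'cV[R]_m) (xi : 'I_3 -> 'cV[R]_m -> 'cV[R]_m).
Variables (P : 'I_3 -> 'cV[R]_m -> 'M[R]_p) (alpha delta : R).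
Hypotheses (oU : open U) (SEc : forall a, smooth_mx U (Ec a)) (Sxi : forall l, smooth_mx U (xi l)).
Hypothesis SP : forall l, smooth_mx U (P l).
Hypothesis alpha_neq0 : alpha != 0.
Hypothesis xi_indep : forall x, U x -> forall s : 'I_3 -> R,
  \sum_l s l *: xi l x = 0 -> forall l, s l = 0.
Hypothesis bracket_EE : forall a b x, U x ->
  bracket (Ec a) (Ec b) x = \sum_l (- (2 * alpha * P l x a b)) *: xi l x.
Hypothesis bracket_xiE : forall i c x, U x -> bracket (xi i) (Ec c) x = 0.
Hypothesis bracket_xixi : forall i j k x, even_triple i j k -> U x ->
  bracket (xi j) (xi k) x = (2 * delta) *: xi i x.

Lemma commutator_EE a b f x : smooth U f -> U x ->
  along (Ec a) (along (Ec b) f) x - along (Ec b) (along (Ec a) f) x =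
  - (2 * alpha) * \sum_l (P l x a b * along (xi l) f x).
Proof.
move=> Sf Ux; rewrite (along_bracket oU (SEc a) (SEc b) Sf Ux) {1}/along bracket_EE //.
rewrite derive_sumZ; last exact: smooth_differentiable Sf Ux.
by rewrite mulr_sumr; apply: eq_bigr => l _; rewrite /along; ring.
Qed.

Let commutator_xiE i c f x : smooth U f -> U x ->
  along (xi i) (along (Ec c) f) x = along (Ec c) (along (xi i) f) x.
Proof.
move=> Sf Ux; apply/eqP; rewrite -subr_eq0 (along_bracket oU (Sxi i) (SEc c) Sf Ux).
by rewrite /along bracket_xiE // derive0.
Qed.

Let commutator_xixi i j k f x : even_triple i j k -> smooth U f -> U x ->
  along (xi j) (along (xi k) f) x - along (xi k) (along (xi j) f) x =
  2 * delta * along (xi i) f x.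
Proof.
move=> e Sf Ux; rewrite (along_bracket oU (Sxi j) (Sxi k) Sf Ux) {1}/along (bracket_xixi e) //.
have df : differentiable f x by exact: smooth_differentiable Sf Ux.
by rewrite deriveE // linearZ /= -deriveE.
Qed.

Let xi_free (s : 'I_3 -> R) x : U x ->
  (forall f, smooth U f -> \sum_l s l * along (xi l) f x = 0) -> forall l, s l = 0.
Proof.
move=> Ux H0 l.
have v0 : \sum_l s l *: xi l x = 0.
  apply/matrixP => i j; rewrite ord1 [RHS]mxE summxE.
  apply: etrans (H0 _ (smooth_coord i oU)); apply: eq_bigr => k _.
  by rewrite mxE /along derive_coord.
exact: (xi_indep Ux v0 l).
Qed.

Let SEcf a f : smooth U f -> smooth U (along (Ec a) f).
Proof. by move=> Sf; exact: smooth_along. Qed.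

Let Sxif l f : smooth U f -> smooth U (along (xi l) f).
Proof. by move=> Sf; exact: smooth_along. Qed.

Let along_sub X (f1 f2 f3 : 'cV[R]_m -> R) x : smooth U f1 -> smooth U f2 -> U x ->
  (forall y, U y -> f1 y - f2 y = f3 y) -> along X f1 x - along X f2 x = along X f3 x.
Proof.
move=> S1 S2 Ux e; rewrite /along -(derive_open_eq (f := fun y => f1 y - f2 y) _ oU Ux e).
by rewrite [RHS]deriveB //; [exact: smooth_derivable oU S1 Ux|exact: smooth_derivable oU S2 Ux].
Qed.

Let along_commutator_EE X a b f x : smooth U f -> U x ->
  along X (along (Ec a) (along (Ec b) f)) x - along X (along (Ec b) (along (Ec a) f)) x
  = - (2 * alpha) * \sum_l (along X (fun y => P l y a b) x * along (xi l) f x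
                             + P l x a b * along X (along (xi l) f) x).
Proof.
move=> Sf Ux.
have e := @along_sub X _ _ (fun y => - (2 * alpha) * \sum_l (P l y a b * along (xi l) f y)) x
  (SEcf a (SEcf b Sf)) (SEcf b (SEcf a Sf)) Ux (fun y Uy => commutator_EE a b Sf Uy).
rewrite e; exact: (derive_sum_mul _ _ oU Ux (fun l => SP l a b) (fun l => Sxif l Sf)).
Qed.

(** The operator [E_c, [E_a, E_b]] has no term P_l [E_c, xi_l], because the
    lifts commute with the Reeb fields. *)
Let double_commutator c a b f x : smooth U f -> U x ->
  along (Ec c) (along (Ec a) (along (Ec b) f)) x - along (Ec c) (along (Ec b) (along (Ec a) f)) x
  - (along (Ec a) (along (Ec b) (along (Ec c) f)) x - along (Ec b) (along (Ec a) (along (Ec c) f)) x)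
  = - (2 * alpha) * \sum_l (along (Ec c) (fun y => P l y a b) x * along (xi l) f x).
Proof.
move=> Sf Ux.
apply: etrans (congr2 (fun u v => u - v) (along_commutator_EE (Ec c) a b Sf Ux)
  (commutator_EE a b (SEcf c Sf) Ux)) _.
rewrite -mulrBr -sumrB; congr (_ * _); apply: eq_bigr => l _.
by rewrite (commutator_xiE l c Sf Ux) addrK.
Qed.

(** The Jacobi identity for three lifts, read off on the coefficients of the
    xi_l; division by alpha is what makes the forms P_l closed. *)
Lemma dP_cyclic l a b c x : U x ->
  along (Ec c) (fun y => P l y a b) x + along (Ec a) (fun y => P l y b c) x
  + along (Ec b) (fun y => P l y c a) x = 0.
Proof.
move=> Ux; move: l; apply: (xi_free Ux) => f Sf.
have n2a : - (2 * alpha) != 0 by rewrite oppr_eq0 mulf_neq0 // pnatr_eq0.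
have := jacobi_sum (N := fun c a b => along (Ec c) (along (Ec a) (along (Ec b) f)) x)
   (S := fun c a b => \sum_l (along (Ec c) (fun y => P l y a b) x * along (xi l) f x)) n2a
   (fun c a b => double_commutator c a b Sf Ux) c a b.
move=> e; apply: etrans e; rewrite -!big_split /=; apply: eq_bigr => l _.
by rewrite !mulrDl.
Qed.

(** The Jacobi identity for xi_i and two lifts: xi_i commutes with
    [E_a, E_b] = - 2 alpha sum_l P_l(a,b) xi_l, so its action on the
    coefficients compensates its brackets with the xi_l. *)
Lemma dP_xi i j k a b x : even_triple i j k -> U x ->
  [/\ along (xi i) (fun y => P i y a b) x = 0,
      along (xi i) (fun y => P j y a b) x = 2 * delta * P k x a b &
      along (xi i) (fun y => P k y a b) x = - (2 * delta * P j x a b)].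
Proof.
move=> e Ux; have e' := even_triple_cycle e; have e'' := even_triple_cycle e'.
have neqF := even_triple_eqF e.
pose s l := along (xi i) (fun y => P l y a b) x
   - (if l == j then 2 * delta * P k x a b else if l == k then - (2 * delta * P j x a b) else 0).
have s0 : forall l, s l = 0.
  apply: (xi_free Ux) => f Sf.
  have C u v : along (xi i) (along (Ec u) (along (Ec v) f)) x = along (Ec u) (along (Ec v) (along (xi i) f)) x.
    rewrite (commutator_xiE i u (SEcf v Sf) Ux).
    by apply: (derive_open_eq _ oU Ux) => y Uy; exact: commutator_xiE.
  have := etrans (esym (along_commutator_EE (xi i) a b Sf Ux))
    (etrans (congr2 (fun u v => u - v) (C a b) (C b a)) (commutator_EE a b (Sxif i Sf) Ux)).
  have n2a : - (2 * alpha) != 0 by rewrite oppr_eq0 mulf_neq0 // pnatr_eq0.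
  move=> /(mulfI n2a); rewrite !(sum_even_triple _ e) /s.
  rewrite !neqF !eqxx.
  have := commutator_xixi e' Sf Ux; have := commutator_xixi e'' Sf Ux.
  move=> c1 c2 c3'; exact: xi_coefficients c2 c1 c3'.
split; [have := s0 i|have := s0 j|have := s0 k]; rewrite /s.
- by rewrite !neqF subr0.
- by rewrite eqxx => /eqP; rewrite subr_eq0 => /eqP.
by rewrite !neqF eqxx => /eqP; rewrite subr_eq0 => /eqP.
Qed.
End JacobiIdentities.

(** * Curvature of the base *)

Lemma trilinear_cyclic (R : comRingType) (p : nat) (A : 'I_p -> 'M[R]_p) :
  (forall c a b, A c a b + A a b c + A b c a = 0) -> forall X Y Z : 'cV[R]_p,
  (Y^T *m (\sum_c X c 0 *: A c) *m Z) 0 0 + (Z^T *m (\sum_c Y c 0 *: A c) *m X) 0 0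
  + (X^T *m (\sum_c Z c 0 *: A c) *m Y) 0 0 = 0.
Proof.
move=> cyc X Y Z.
have E (X' Y' Z' : 'cV[R]_p) : (Y'^T *m (\sum_c X' c 0 *: A c) *m Z') 0 0 =
    \sum_c \sum_a \sum_b X' c 0 * Y' a 0 * Z' b 0 * A c a b.
  rewrite mulmx_sumr mulmx_suml summxE; apply: eq_bigr => c _.
  rewrite -scalemxAr -scalemxAl mxE -mulmxA mxE mulr_sumr; apply: eq_bigr => a _.
  by rewrite !mxE !mulr_sumr; apply: eq_bigr => b _; ring.
have rot (f : 'I_p -> 'I_p -> 'I_p -> R) :
    \sum_c \sum_a \sum_b f c a b = \sum_c \sum_a \sum_b f a b c.
  by rewrite [RHS]exchange_big; apply: eq_bigr => a _; exact: exchange_big.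
rewrite !E (rot (fun c a b => Y c 0 * Z a 0 * X b 0 * A c a b)).
rewrite (rot (fun c a b => Z c 0 * X a 0 * Y b 0 * A c a b)).
rewrite (rot (fun c a b => Z a 0 * X b 0 * Y c 0 * A a b c)) -!big_split big1 // => c _ /=.
rewrite -!big_split big1 // => a _; rewrite -!big_split big1 // => b _ /=.
by rewrite -[RHS](mulr0 (X c 0 * Y a 0 * Z b 0)) -(cyc c a b); ring.
Qed.

(** N G is the derivative of a parallel form Q in a direction with connection
    matrix G, and DD dG G1 G2 its second derivative; dGab is the derivative of
    Gb in the direction a. The antisymmetrized second derivative is the
    action of the curvature on Q. *)
Lemma curvature_commutator (R : comRingType) (p : nat) (Q Ga Gb dGab dGba : 'M[R]_p) :
  let N G := G^T *m Q + Q *m G in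
  let DD dG G1 G2 := dG^T *m Q + G2^T *m N G1 + (N G1 *m G2 + Q *m dG) in
  DD dGab Ga Gb - DD dGba Gb Ga =
  (dGab - dGba + (Ga *m Gb - Gb *m Ga))^T *m Q + Q *m (dGab - dGba + (Ga *m Gb - Gb *m Ga)).
Proof.
have trB (A B : 'M[R]_p) : (A - B)^T = A^T - B^T by apply/matrixP => i j; rewrite !mxE.
have trD (A B : 'M[R]_p) : (A + B)^T = A^T + B^T by apply/matrixP => i j; rewrite !mxE.
rewrite /= trD !trB !trmx_mul !(mulmxDl, mulmxDr, mulNmx, mulmxN, mulmxA).
move: (dGab^T *m Q) (dGba^T *m Q) (Q *m dGab) (Q *m dGba) (Gb^T *m Ga^T *m Q)
 (Gb^T *m Q *m Ga) (Ga^T *m Gb^T *m Q) (Ga^T *m Q *m Gb) (Q *m Ga *m Gb) (Q *m Gb *m Ga) => *.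
by apply/matrixP => i j; rewrite !mxE; ring.
Qed.

(** The base map F enters only through E_c F^d = delta_cd and xi_l F = 0, so that
    on functions of the base E_c is the c-th partial derivative and xi_l is
    zero. *)
Section BaseCurvature.
Context {R : realType} {m p : nat}.
Variables (U : set 'cV[R]_m) (V : set 'cV[R]_p).
Variables (F : 'cV[R]_m -> 'cV[R]_p) (h : 'cV[R]_p -> 'M[R]_p).
Variables (Ec : 'I_p -> 'cV[R]_m -> 'cV[R]_m) (xi : 'I_3 -> 'cV[R]_m -> 'cV[R]_m).
Variables (P J : 'I_3 -> 'cV[R]_m -> 'M[R]_p) (alpha delta : R).
Hypotheses (oU : open U) (oV : open V) (FV : forall x, U x -> V (F x)).
Hypotheses (SF : smooth_mx U F) (Sh : smooth_mx V h).
Hypotheses (symh : forall y, V y -> (h y)^T = h y) (unith : forall y, V y -> h y \in unitmx).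
Hypothesis SJ : forall i, smooth_mx U (J i).
Hypothesis SP : forall i, smooth_mx U (P i).
Hypothesis SH : smooth_mx U (fun x => h (F x)).
Hypothesis dF_E : forall c d x, U x -> 'D_(Ec c x) (fun y => F y d 0) x = (d == c)%:R.
Hypothesis dF_xi : forall l d x, U x -> 'D_(xi l x) (fun y => F y d 0) x = 0.
Hypothesis PJ : forall i x, U x -> P i x = h (F x) *m J i x.
Hypothesis P_skew : forall i x, U x -> (P i x)^T = - P i x.
Hypothesis J_quat : forall i j k x, even_triple i j k -> U x -> quaternionic (J i x) (J j x) (J k x).
Hypothesis P_cyclic : forall l a b c x, U x ->
  along (Ec c) (fun y => P l y a b) x + along (Ec a) (fun y => P l y b c) x
  + along (Ec b) (fun y => P l y c a) x = 0.
Hypothesis P_xi : forall i j k a b x, even_triple i j k -> U x ->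
  [/\ along (xi i) (fun y => P i y a b) x = 0,
      along (xi i) (fun y => P j y a b) x = 2 * delta * P k x a b &
      along (xi i) (fun y => P k y a b) x = - (2 * delta * P j x a b)].
Hypothesis commutator : forall a b f x, smooth U f -> U x ->
  along (Ec a) (along (Ec b) f) x - along (Ec b) (along (Ec a) f) x =
  - (2 * alpha) * \sum_l (P l x a b * along (xi l) f x).

Local Notation Gam c x := (christoffel_mx h c (F x)).
Local Notation Rm a b x := (riemann_mx h a b (F x)).

Lemma derive_F_component d x : U x -> differentiable (fun y => F y d 0) x.
Proof. by move=> Ux; exact: smooth_differentiable (SF d 0) Ux. Qed.

Lemma along_E_basic c (u : 'cV[R]_p -> R) x : smooth V u -> U x ->
  derivable (fun y => u (F y)) x (Ec c x) /\
  'D_(Ec c x) (fun y => u (F y)) x = partial c u (F x).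
Proof.
move=> Su Ux.
have [d ->] := @derive_comp _ _ _ u F x (Ec c x) (smooth_differentiable oV Su (FV Ux))
  (fun d => derive_F_component d Ux).
split=> //; rewrite (bigD1 c) //= dF_E // eqxx mulr1 big1 ?addr0 // => d' dc.
by rewrite dF_E // (negbTE dc) mulr0.
Qed.

Lemma along_xi_basic l (u : 'cV[R]_p -> R) x : smooth V u -> U x ->
  'D_(xi l x) (fun y => u (F y)) x = 0.
Proof.
move=> Su Ux.
have [_ ->] := @derive_comp _ _ _ u F x (xi l x) (smooth_differentiable oV Su (FV Ux))
  (fun d => derive_F_component d Ux).
by rewrite big1 // => d _; rewrite dF_xi // mulr0.
Qed.

(** Horizontally parallel for the pulled back connection; the derivatives along
    the Reeb fields are not constrained. *)
Definition parallel (Q : 'cV[R]_m -> 'M[R]_p) := forall c x, U x ->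
  derive_entries (Ec c x) Q x = (Gam c x)^T *m Q x + Q x *m Gam c x.

Lemma metric_parallel : parallel (fun x => h (F x)).
Proof.
move=> c x Ux; apply/matrixP => a b; rewrite mxE.
rewrite (along_E_basic c (Sh a b) Ux).2 (christoffel_metric oV symh unith) //; exact: FV.
Qed.

Lemma christoffel_derive a b x : U x ->
  derivable_entries (Ec a x) (fun y => Gam b y) x /\
  derive_entries (Ec a x) (fun y => Gam b y) x =
  derive_entries (delta_mx a 0) (christoffel_mx h b) (F x).
Proof.
move=> Ux; have S d e := smooth_christoffel oV Sh unith d b e.
have E d e : (fun y => christoffel_mx h b y d e) = christoffel h d b e by apply/funext => y; rewrite mxE.
have E' d e : (fun y => Gam b y d e) = (fun y => christoffel h d b e (F y)) by apply/funext => y; rewrite mxE.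
split=> [d e|]; first by rewrite E'; exact: (along_E_basic a (S d e) Ux).1.
by apply/matrixP => d e; rewrite [LHS]mxE [RHS]mxE E E' (along_E_basic a (S d e) Ux).2.
Qed.

Lemma parallel_second Q a b x : smooth_mx U Q -> parallel Q -> U x ->
  \matrix_(c, d) along (Ec a) (along (Ec b) (fun y => Q y c d)) x =
  (derive_entries (delta_mx a 0) (christoffel_mx h b) (F x))^T *m Q x
  + (Gam b x)^T *m ((Gam a x)^T *m Q x + Q x *m Gam a x)
  + (((Gam a x)^T *m Q x + Q x *m Gam a x) *m Gam b x
     + Q x *m derive_entries (delta_mx a 0) (christoffel_mx h b) (F x)).
Proof.
move=> SQ pQ Ux; have [dG eG] := christoffel_derive a b Ux.
have dQ := smooth_derivable_entries (v := Ec a x) oU SQ Ux.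
have [d1 e1] := derivable_entriesM (derivable_entriesT dG) dQ.
have [d2 e2] := derivable_entriesM dQ dG.
have e : derive_entries (Ec a x) (fun y => derive_entries (Ec b y) Q y) x =
   derive_entries (Ec a x) (fun y => (Gam b y)^T *m Q y + Q y *m Gam b y) x.
  by apply: (derive_entries_eq _ oU Ux) => y Uy; exact: pQ.
rewrite (derive_entriesD d1 d2) e1 e2 derive_entriesT eG (pQ _ _ Ux) in e.
rewrite -e; apply/matrixP => c d; rewrite [LHS]mxE [RHS]mxE.
by congr ('D_ _ _ x); apply/funext => y; rewrite mxE.
Qed.

(** The Ricci identity: the commutator of E_a and E_b on a parallel form is the
    action of the curvature, and by the bracket relation it is a derivative
    along the Reeb fields. *)
Lemma curvature_parallel Q a b x : smooth_mx U Q -> parallel Q -> U x ->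
  \matrix_(c, d) (- (2 * alpha) * \sum_l (P l x a b * along (xi l) (fun y => Q y c d) x)) =
  (Rm a b x)^T *m Q x + Q x *m Rm a b x.
Proof.
move=> SQ pQ Ux; rewrite riemann_mxE -curvature_commutator /=.
apply: etrans (congr2 (fun A B => A - B) (parallel_second a b SQ pQ Ux)
  (parallel_second b a SQ pQ Ux)).
apply/matrixP => c d; rewrite [LHS]mxE [RHS]mxE [X in _ + X]mxE [X in X - _]mxE [X in _ - X]mxE.
exact: esym (commutator a b (SQ c d) Ux).
Qed.

(** The covariant derivative of a field of endomorphisms along E_c. *)
Definition nabla c (A : 'cV[R]_m -> 'M[R]_p) x : 'M[R]_p :=
  derive_entries (Ec c x) A x + (Gam c x *m A x - A x *m Gam c x).

Lemma nablaM c A B x : smooth_mx U A -> smooth_mx U B -> U x ->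
  nabla c (fun y => A y *m B y) x = nabla c A x *m B x + A x *m nabla c B x.
Proof.
move=> SA SB Ux; rewrite /nabla (derive_entriesM _ oU Ux SA SB) !mulmxDl !mulmxDr !mulNmx !mulmxN !mulmxA.
move: (derive_entries _ A x *m B x) (A x *m derive_entries _ B x) (Gam c x *m A x *m B x)
  (A x *m Gam c x *m B x) (A x *m B x *m Gam c x) => u v w s t.
by apply/matrixP => i j; rewrite !mxE; ring.
Qed.

Lemma nablaN c A x : smooth_mx U A -> U x -> nabla c (fun y => - A y) x = - nabla c A x.
Proof.
move=> SA Ux; rewrite /nabla (derive_entriesN (smooth_derivable_entries oU SA Ux)).
by rewrite mulmxN mulNmx !opprD.
Qed.

Lemma nabla1 c x : nabla c (fun=> 1%:M) x = 0.
Proof. by rewrite /nabla derive_entries_cst mulmx1 mul1mx subrr addr0. Qed.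

Lemma eq_nabla c A B x : U x -> (forall y, U y -> A y = B y) -> nabla c A x = nabla c B x.
Proof. by move=> Ux AB; rewrite /nabla (derive_entries_eq _ oU Ux AB) AB. Qed.

Let nablaJ x i (X : 'cV[R]_p) : 'M[R]_p := \sum_c X c 0 *: nabla c (J i) x.

Let nablaJN x i X : nablaJ x i (- X) = - nablaJ x i X.
Proof. by rewrite /nablaJ -sumrN; apply: eq_bigr => c _; rewrite mxE scaleNr. Qed.

Let S1 : smooth_mx U (fun=> 1%:M : 'M[R]_p).
Proof. by move=> i j; exact: smooth_cst. Qed.

Let nablaJ_mul x i j (X : 'cV[R]_p) (K : 'cV[R]_m -> 'M[R]_p) : U x -> (forall y, U y -> J i y *m J j y = K y) ->
  \sum_c X c 0 *: nabla c K x = nablaJ x i X *m J j x + J i x *m nablaJ x j X.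
Proof.
move=> Ux JK; rewrite /nablaJ mulmx_suml mulmx_sumr -big_split; apply: eq_bigr => c _ /=.
by rewrite -scalemxAl -scalemxAr -scalerDr -nablaM // (eq_nabla c Ux JK).
Qed.

Let nablaJ_sqr x i X : U x -> nablaJ x i X *m J i x = - (J i x *m nablaJ x i X).
Proof.
move=> Ux; have [j [k e]] := even_triple_first i.
have := nablaJ_mul X Ux (fun y Uy => quat11 (J_quat e Uy)).
rewrite big1 => [/esym/eqP|c _]; first by rewrite addr_eq0 => /eqP.
by rewrite nablaN // nabla1 oppr0 scaler0.
Qed.

Let nablaJ_mulP x i j k X : even_triple i j k -> U x ->
  nablaJ x k X = nablaJ x i X *m J j x + J i x *m nablaJ x j X.
Proof. by move=> e Ux; exact: (nablaJ_mul X Ux (fun y Uy => quat12 (J_quat e Uy))). Qed.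

Let nablaJ_mulN x i j k X : even_triple i j k -> U x ->
  - nablaJ x k X = nablaJ x j X *m J i x + J j x *m nablaJ x i X.
Proof.
move=> e Ux; rewrite -(nablaJ_mul X Ux (fun y Uy => quat21 (J_quat e Uy))) /nablaJ -sumrN.
by apply: eq_bigr => c _; rewrite nablaN // scalerN.
Qed.

Let nablaJ_derivation x i j k : even_triple i j k -> U x ->
  quat_derivation (J i x) (J j x) (J k x) (nablaJ x i) (nablaJ x j) (nablaJ x k).
Proof.
move=> e Ux; have e' := even_triple_cycle e; have e'' := even_triple_cycle e'.
split=> X; try exact: nablaJ_sqr.
- exact: nablaJ_mulP e Ux.
- exact: nablaJ_mulP e' Ux.
- exact: nablaJ_mulP e'' Ux.
- exact: nablaJ_mulN e Ux.
- exact: nablaJ_mulN e' Ux.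
- exact: nablaJ_mulN e'' Ux.
Qed.

Lemma nabla_form c i x : U x -> h (F x) *m nabla c (J i) x =
  derive_entries (Ec c x) (P i) x - (Gam c x)^T *m P i x - P i x *m Gam c x.
Proof.
move=> Ux; have -> : derive_entries (Ec c x) (P i) x = derive_entries (Ec c x) (fun y => h (F y) *m J i y) x.
  by apply: (derive_entries_eq _ oU Ux) => y Uy; exact: PJ.
rewrite (derive_entriesM _ oU Ux SH (SJ i)) (metric_parallel c Ux) PJ // /nabla.
rewrite !mulmxDr !mulmxDl mulmxN !mulmxA.
move: (h (F x) *m derive_entries _ (J i) x) ((Gam c x)^T *m h (F x) *m J i x)
  (h (F x) *m Gam c x *m J i x) (h (F x) *m J i x *m Gam c x) => u v w s.
by apply/matrixP => a b; rewrite !mxE; ring.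
Qed.

Let nabla_form_skew c i x : U x ->
  (h (F x) *m nabla c (J i) x)^T = - (h (F x) *m nabla c (J i) x).
Proof.
move=> Ux; rewrite nabla_form //.
have dsk : (derive_entries (Ec c x) (P i) x)^T = - derive_entries (Ec c x) (P i) x.
  rewrite -derive_entriesT -(derive_entriesN (smooth_derivable_entries oU (SP i) Ux)).
  by apply: (derive_entries_eq _ oU Ux) => y Uy; exact: P_skew.
have trB (A B : 'M[R]_p) : (A - B)^T = A^T - B^T by apply/matrixP => a b; rewrite !mxE.
rewrite !trB dsk !trmx_mul trmxK P_skew // mulNmx mulmxN !opprD !opprK.
by rewrite addrAC.
Qed.

(** The Christoffel terms drop out of the cyclic sum because the connection is
    torsion free: what remains is the exterior derivative of P_i. *)
Let nabla_form_cyclic i x : U x -> forall c a b,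
  (h (F x) *m nabla c (J i) x) a b + (h (F x) *m nabla a (J i) x) b c
  + (h (F x) *m nabla b (J i) x) c a = 0.
Proof.
move=> Ux.
pose L c a b := ((Gam c x)^T *m P i x) a b.
have PG c a b : (P i x *m Gam c x) a b = - L c b a.
  rewrite -[P i x *m _]trmxK trmx_mul P_skew // mulmxN [LHS]mxE [LHS]mxE.
  by [].
have Lsym c a b : L c a b = L a c b.
  rewrite /L [LHS]mxE [RHS]mxE; apply: eq_bigr => d _; congr (_ * _); rewrite 4!mxE.
  exact: (christoffel_sym oV symh d c a (FV Ux)).
have E c a b : (h (F x) *m nabla c (J i) x) a b =
   along (Ec c) (fun y => P i y a b) x - L c a b + L c b a.
  by rewrite nabla_form // [LHS]mxE [X in _ + X]mxE PG [X in X + _]mxE [X in X + _ + _]mxE [X in _ + X + _]mxE opprK.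
have alg (u v w l1 l2 l3 r1 r2 r3 : R) : l1 = r2 -> l2 = r3 -> l3 = r1 -> u + v + w = 0 ->
    u - l1 + r1 + (v - l2 + r2) + (w - l3 + r3) = 0.
  by move=> -> -> -> <-; ring.
move=> c a b; apply: etrans (congr2 +%R (congr2 +%R (E c a b) (E a b c)) (E b c a)) _.
exact: alg (Lsym c a b) (Lsym a b c) (Lsym b c a) (P_cyclic i a b c Ux).
Qed.

(** The forms P_l are closed along the lifts, so each J_l is of almost Kaehler
    type, and [quat_derivation_eq0] applies. *)
Lemma P_parallel i : parallel (P i).
Proof.
move=> c x Ux.
have uH : h (F x) \in unitmx by exact/unith/FV.
have [k [j e0]] := even_triple_first i; have e1 := even_triple_cycle e0; have e := even_triple_cycle e1.
have type l X : nablaJ x l (J l x *m X) = nablaJ x l X *m J l x.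
  have [q1 [q2 eq]] := even_triple_first l.
  apply: (almost_kahler_type uH) => [|||Y|X' Y Z]; last 2 first.
  - rewrite /nablaJ mulmx_sumr raddf_sum -sumrN; apply: eq_bigr => d _ /=.
    by rewrite -scalemxAr linearZ /= nabla_form_skew // scalerN.
  - have := trilinear_cyclic (nabla_form_cyclic l Ux) X' Y Z.
    have HB (W : 'cV[R]_p) : \sum_d W d 0 *: (h (F x) *m nabla d (J l) x) = h (F x) *m nablaJ x l W.
      by rewrite /nablaJ mulmx_sumr; apply: eq_bigr => d _; rewrite -scalemxAr.
    by rewrite !HB !mulmxA.
  - exact: quat11 (J_quat eq Ux).
  - by rewrite -{1}(symh (FV Ux)) -trmx_mul -PJ // P_skew.
  - by move=> Y; exact: nablaJ_sqr.
have B0 := quat_derivation_eq0 (J_quat e Ux) (nablaJ_derivation e Ux) (type _) (type _) (type _)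
  (@nablaJN x _) (@nablaJN x _) (@nablaJN x _).
have n0 : nabla c (J i) x = 0.
  rewrite -(B0 (delta_mx c 0)) /nablaJ (bigD1 c) //= big1 ?addr0 ?mxE ?eqxx ?scale1r // => d dc.
  by rewrite mxE (negbTE dc) scale0r.
have := nabla_form c i Ux; rewrite n0 mulmx0 => /esym/eqP.
by rewrite subr_eq0 subr_eq addrC => /eqP.
Qed.

Lemma curvature_metric a b x : U x ->
  (Rm a b x)^T *m h (F x) + h (F x) *m Rm a b x = 0.
Proof.
move=> Ux; rewrite -(curvature_parallel a b SH metric_parallel Ux).
apply/matrixP => c d; rewrite mxE [RHS]mxE big1 ?mulr0 // => l _.
by rewrite /along (along_xi_basic l (Sh c d) Ux) mulr0.
Qed.

(** The Ricci identity for P_i = h J_i: on the left only xi_j P_i and xi_k P_i are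
    nonzero, and skewness of the curvature turns its action on P_i into a
    commutator with J_i. *)
Lemma curvature_J i j k a b x : even_triple i j k -> U x ->
  J i x *m Rm a b x - Rm a b x *m J i x =
  (4 * alpha * delta) *: ((h (F x) *m J j x) a b *: J k x - (h (F x) *m J k x) a b *: J j x).
Proof.
move=> e Ux; have e' := even_triple_cycle e; have e'' := even_triple_cycle e'.
have uH : h (F x) \in unitmx by exact/unith/FV.
have C := curvature_parallel a b (SP i) (P_parallel i) Ux.
have L : \matrix_(c, d) (- (2 * alpha) * \sum_l (P l x a b * along (xi l) (fun y => P i y c d) x)) =
    (4 * alpha * delta) *: (P j x a b *: P k x - P k x a b *: P j x).
  apply/matrixP => c d; rewrite mxE (sum_even_triple _ e).
  have [a1 _ _] := P_xi c d e Ux; have [_ _ a2] := P_xi c d e' Ux; have [_ a3 _] := P_xi c d e'' Ux.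
  by rewrite a1 a2 a3 !mxE; ring.
have hR : (Rm a b x)^T *m h (F x) = - (h (F x) *m Rm a b x).
  by apply/eqP; rewrite -addr_eq0 curvature_metric.
rewrite {}L (PJ i Ux) mulmxA hR in C.
have {C} : h (F x) *m (J i x *m Rm a b x - Rm a b x *m J i x) =
    h (F x) *m ((4 * alpha * delta) *: ((h (F x) *m J j x) a b *: J k x - (h (F x) *m J k x) a b *: J j x)).
  rewrite mulmxDr mulmxN !mulmxA addrC -mulNmx -C (PJ j Ux) (PJ k Ux).
  by rewrite -scalemxAr mulmxDr mulmxN -!scalemxAr.
by move=> /(congr1 (mulmx (invmx (h (F x))))); rewrite !mulKmx.
Qed.

Lemma base_scalar_curvature x : U x ->
  4 * scalar_curvature h (F x) = 4 * alpha * delta * p%:R * (p%:R + 8).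
Proof.
move=> Ux; have [j [k e]] := even_triple_first 0.
have e' := even_triple_cycle e; have e'' := even_triple_cycle e'.
have skew l : (h (F x) *m J l x)^T = - (h (F x) *m J l x) by rewrite -PJ // P_skew.
rewrite -(@scalar_curvature_mx _ _ (h (F x)) (J 0 x) (J j x) (J k x) (fun a b => Rm a b x)
  (4 * alpha * delta)) //.
- congr (_ * _); apply: eq_bigr => c _; apply: eq_bigr => d _; congr (_ * _).
  by apply: eq_bigr => b _; rewrite mxE.
- exact/symh/FV.
- exact/unith/FV.
- exact: J_quat e Ux.
- by move=> a b; exact: riemann_mx_skew.
- by move=> a b; exact: curvature_metric.
- by move=> l d a b; exact: riemann_bianchi oV symh _ _ _ _ _ (FV Ux).
- by move=> a b; exact: curvature_J e Ux.
- by move=> a b; exact: curvature_J e'' Ux.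
Qed.

End BaseCurvature.

(** * The frame of the submersion in a pair of charts *)

Section LocalGeometry.
Context {R : realType} {p : nat}.
Variables (U : set 'cV[R]_(p + 3)) (V : set 'cV[R]_p).
Variables (F : 'cV[R]_(p + 3) -> 'cV[R]_p) (h : 'cV[R]_p -> 'M[R]_p).
Variables (phi : 'I_3 -> 'cV[R]_(p + 3) -> 'M[R]_(p + 3)).
Variables (xi : 'I_3 -> 'cV[R]_(p + 3) -> 'cV[R]_(p + 3)).
Variables (eta : 'I_3 -> 'cV[R]_(p + 3) -> 'rV[R]_(p + 3)).
Variables (g : 'cV[R]_(p + 3) -> 'M[R]_(p + 3)) (alpha delta : R).
Hypotheses (oU : open U) (oV : open V) (FV : forall x, U x -> V (F x)).
Hypotheses (SF : smooth_mx U F) (Sh : smooth_mx V h).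
Hypotheses (Sphi : forall i, smooth_mx U (phi i)) (Sxi : forall i, smooth_mx U (xi i)).
Hypotheses (Seta : forall i, smooth_mx U (eta i)) (Sg : smooth_mx U g).
Hypotheses (symh : forall y, V y -> (h y)^T = h y) (unith : forall y, V y -> h y \in unitmx).
Hypothesis c3 : forall x, U x -> contact3 (phi^~ x) (xi^~ x) (eta^~ x) (g x).
Hypothesis kerF : forall x, U x -> forall v : 'cV[R]_(p + 3),
  jacobian_mx F x *m v = 0 <-> exists b : 'I_3 -> R, v = \sum_i b i *: xi i x.
Hypothesis isoF : forall x, U x -> forall u v : 'cV[R]_(p + 3),
  (forall w, jacobian_mx F x *m w = 0 -> bilin (g x) u w = 0) ->
  (forall w, jacobian_mx F x *m w = 0 -> bilin (g x) v w = 0) ->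
  bilin (h (F x)) (jacobian_mx F x *m u) (jacobian_mx F x *m v) = bilin (g x) u v.
Hypothesis dEta : forall i j k, even_triple i j k -> forall x, U x -> forall u v : 'cV[R]_(p + 3),
  ext_d (eta i) (fun=> u) (fun=> v) x = 2 * alpha * bilin (g x) u (phi i x *m v)
    + 2 * (alpha - delta) * wedge (eta j x) (eta k x) u v.
Hypothesis alpha_neq0 : alpha != 0.

Let T x := jacobian_mx F x.
Let E x := hlift (T x) (eta^~ x).
Let Ec a x := col a (E x).
Let J i x := baseJ (phi^~ x) (T x) (E x) i.
Let P i x := (E x)^T *m g x *m phi i x *m E x.
Let H x := h (F x).

Let pairing_eta_xi_at x i j : U x -> pairing (eta i x) (xi j x) = (i == j)%:R.
Proof. by move=> /c3 c; exact: (pairing_eta_xi c). Qed.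

Let vert x v : U x -> T x *m v = 0 -> v = \sum_i pairing (eta i x) v *: xi i x.
Proof.
move=> Ux; exact: (@vertical_decomposition _ _ (phi^~ x) (xi^~ x) (eta^~ x) _ (c3 Ux) _ (T x) (kerF Ux)).
Qed.

Let unit_frame x : U x -> frame_mx (T x) (eta^~ x) \in unitmx.
Proof.
move=> Ux; apply: (@frame_mx_unit _ _ _ _ (xi^~ x)) => v.
exact: vert.
Qed.

Let TE x : U x -> T x *m E x = 1%:M.
Proof. by move=> /unit_frame/frame_hlift[]. Qed.

Let etaE x i : U x -> eta i x *m E x = 0.
Proof. by move=> /unit_frame/frame_hlift[]. Qed.

Let T_xi_at x i : U x -> T x *m xi i x = 0.
Proof. by move=> Ux; exact: (@T_xi _ _ (xi^~ x) _ (T x) (kerF Ux)). Qed.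

Let ST : smooth_mx U T.
Proof.
move=> i j; apply: (eq_smooth oU (f := partial j (fun y => F y i 0))) => [y _|]; first by rewrite mxE.
exact: smooth_partial.
Qed.

Let SE : smooth_mx U E.
Proof.
have SA : smooth_mx U (fun x => frame_mx (T x) (eta^~ x)).
  move=> i j; rewrite /frame_mx; case: (split_ordP i) => k ->.
    by apply: (eq_smooth oU _ (ST k j)) => y _; rewrite col_mxEu.
  by apply: (eq_smooth oU _ (Seta k 0 j)) => y _; rewrite col_mxEd mxE.
move=> i j; have := smooth_invmx oU unit_frame SA i (lshift 3 j).
by apply: eq_smooth => // y _; rewrite [RHS]mxE.
Qed.

Let SEc a : smooth_mx U (Ec a).
Proof. by move=> i j; apply: (eq_smooth oU _ (SE i a)) => y _; rewrite [RHS]mxE. Qed.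

Let SJ i : smooth_mx U (J i).
Proof. by apply: smooth_mxM => //; apply: smooth_mxM. Qed.

Let SP i : smooth_mx U (P i).
Proof. by do 3?[apply: smooth_mxM => //]; exact: smooth_mxT. Qed.

(** The lifts are orthogonal to the Reeb fields, since g(u, xi_i) = eta_i(u), so
    the submersion is isometric on them. *)
Let HE x : U x -> H x = (E x)^T *m g x *m E x.
Proof.
move=> Ux; apply/matrixP => a b; rewrite -!bilin_entry.
have hor c : forall w, T x *m w = 0 -> bilin (g x) (E x *m delta_mx c 0) w = 0.
  move=> w /(vert Ux) ->.
  rewrite /bilin mulmx_sumr summxE big1 // => l _; rewrite -scalemxAr mxE.
  rewrite -/(bilin _ _ _) (bilin_xi (c3 Ux)) {2}/pairing mulmxA etaE // mul0mx.
  by rewrite [X in _ * X]mxE mulr0.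
have := isoF Ux (hor a) (hor b); rewrite -/(T x) !mulmxA TE // !mul1mx -/(H x) => ->.
by rewrite /bilin trmx_mul !mulmxA.
Qed.

Let SH : smooth_mx U H.
Proof.
have S : smooth_mx U (fun x => (E x)^T *m g x *m E x).
  by do 2?[apply: smooth_mxM => //]; exact: smooth_mxT.
by move=> i j; apply: (eq_smooth oU _ (S i j)) => y Uy; rewrite HE.
Qed.

Let PJ i x : U x -> P i x = H x *m J i x.
Proof.
move=> Ux; rewrite HE // /P /J -!mulmxA; congr (_ *m (_ *m _)).
exact: (@phi_E _ _ (phi^~ x) (xi^~ x) (eta^~ x) _ (c3 Ux) _ (T x) (E x) (kerF Ux) (TE Ux) (fun i => etaE i Ux)).
Qed.

Let P_skew i x : U x -> (P i x)^T = - P i x.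
Proof. by move=> Ux; exact: (baseP_skew (c3 Ux)). Qed.

Let J_quat i j k x : even_triple i j k -> U x -> quaternionic (J i x) (J j x) (J k x).
Proof.
by move=> e Ux; exact: (@baseJ_quaternionic _ _ (phi^~ x) (xi^~ x) (eta^~ x) _ (c3 Ux) _ (T x) (E x) (kerF Ux) (TE Ux) (fun i => etaE i Ux) _ _ _ e).
Qed.

Let derive_F x v c : U x -> 'D_v (fun y => F y c 0) x = (T x *m v) c 0.
Proof.
move=> Ux; rewrite derive_partials; last exact: smooth_differentiable (SF c 0) Ux.
by rewrite mxE; apply: eq_bigr => j _; rewrite mxE mulrC.
Qed.

(** For fields with constant projection and constant components along the xi_l
    the bracket is vertical, and its components are given by d eta_l. *)
Let basic_bracket X Y x (t s : 'cV[R]_p) (a b : 'I_3 -> R) : U x -> smooth_mx U X -> smooth_mx U Y ->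
  (forall y, U y -> T y *m X y = t) -> (forall y, U y -> T y *m Y y = s) ->
  (forall l y, U y -> pairing (eta l y) (X y) = a l) ->
  (forall l y, U y -> pairing (eta l y) (Y y) = b l) ->
  bracket X Y x = \sum_l - ext_d (eta l) (fun=> X x) (fun=> Y x) x *: xi l x.
Proof.
move=> Ux SX SY tX tY eX eY.
have Tb : T x *m bracket X Y x = 0.
  apply/matrixP => c d; rewrite ord1 -derive_F // [RHS]mxE.
  rewrite -[LHS]/(along (bracket X Y) (fun y => F y c 0) x).
  rewrite -(along_bracket oU SX SY (SF c 0) Ux) /along.
  rewrite (derive_open_eq (g := fun=> s c 0) _ oU Ux); last first.
    by move=> y Uy; rewrite derive_F // tY.
  rewrite [X in _ - X](derive_open_eq (g := fun=> t c 0) _ oU Ux); last first.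
    by move=> y Uy; rewrite derive_F // tX.
  by rewrite !derive_cst subrr.
rewrite (vert Ux Tb); apply: eq_bigr => l _; congr (_ *: _).
rewrite -(ext_d_tensorial oU Ux (Seta l) SX SY) /ext_d /along.
rewrite (derive_open_eq (g := fun=> b l) _ oU Ux); last by move=> y Uy; exact: eY.
rewrite [X in - (_ - X - _)](derive_open_eq (g := fun=> a l) _ oU Ux); last by move=> y Uy; exact: eX.
by rewrite !derive_cst subrr sub0r opprK.
Qed.

Let pairing_eta_Ec l c x : U x -> pairing (eta l x) (Ec c x) = 0.
Proof. by move=> Ux; rewrite /Ec colE /pairing mulmxA etaE // mul0mx mxE. Qed.

Let T_Ec c x : U x -> T x *m Ec c x = delta_mx c 0.
Proof. by move=> Ux; rewrite /Ec colE mulmxA TE // mul1mx. Qed.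

Let bracket_EE a b x : U x ->
  bracket (Ec a) (Ec b) x = \sum_l (- (2 * alpha * P l x a b)) *: xi l x.
Proof.
move=> Ux; rewrite (basic_bracket (t := delta_mx a 0) (s := delta_mx b 0) (a := fun=> 0) (b := fun=> 0)) //; try by move=> *; rewrite ?T_Ec ?pairing_eta_Ec.
apply: eq_bigr => l _; congr (- _ *: _).
have [j [k e]] := even_triple_first l; rewrite (dEta e) // /wedge !pairing_eta_Ec // !mulr0 subrr mulr0 addr0.
congr (_ * _); rewrite /Ec !colE -bilin_entry /bilin trmx_mul !mulmxA.
by [].
Qed.

Let bracket_xiE i c x : U x -> bracket (xi i) (Ec c) x = 0.
Proof.
move=> Ux; rewrite (basic_bracket (t := 0) (s := delta_mx c 0) (a := fun l => (l == i)%:R) (b := fun=> 0)) //; try by move=> *; rewrite ?T_Ec ?pairing_eta_Ec ?T_xi_at ?pairing_eta_xi_at.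
apply: big1 => l _.
have [j [k e]] := even_triple_first l; rewrite (dEta e) // /wedge !pairing_eta_Ec // mulr0 mul0r subrr mulr0 addr0.
rewrite /Ec colE (bilin_xi_phi_E (c3 Ux)) ?mulr0 ?oppr0 ?scale0r // => l'; exact: etaE.
Qed.

Let bracket_xixi i j k x : even_triple i j k -> U x -> bracket (xi j) (xi k) x = (2 * delta) *: xi i x.
Proof.
move=> e Ux; have e' := even_triple_cycle e; have e'' := even_triple_cycle e'.
have neqF := even_triple_eqF e.
rewrite (basic_bracket (t := 0) (s := 0) (a := fun l => (l == j)%:R) (b := fun l => (l == k)%:R)) //; try by move=> *; rewrite ?T_xi_at ?pairing_eta_xi_at.
have c := c3 Ux.
have gxi u l : bilin (g x) (xi l x) u = pairing (eta l x) u.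
  by rewrite (bilin_sym c) (bilin_xi c).
rewrite (sum_even_triple _ e) (dEta e) // (dEta e') // (dEta e'') // /wedge !pairing_eta_xi_at //.
have x1 : xi j x = - (phi i x *m xi k x) by have [_] := c3_xi c e''.
have -> : phi i x *m xi k x = - xi j x by rewrite x1 opprK.
have -> : phi j x *m xi k x = xi i x by have [->] := c3_xi c e'.
rewrite (c3_phi_xi c) !gxi linearN linear0 /= !pairing_eta_xi_at // !eqxx.
rewrite !neqF /= !mulr1n !mulr0n.
rewrite [X in X *: xi j x](_ : _ = 0); last by ring.
rewrite [X in X *: xi k x](_ : _ = 0); last by ring.
by rewrite !scale0r !addr0; congr (_ *: _); ring.
Qed.

Let xi_indep x : U x -> forall s : 'I_3 -> R, \sum_l s l *: xi l x = 0 -> forall l, s l = 0.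
Proof.
move=> Ux s v0 l.
have := congr1 (pairing (eta l x)) v0; rewrite linear0 linear_sum (bigD1 l) //= big1 => [|k kl].
  by rewrite linearZ /= pairing_eta_xi_at // eqxx mulr1 addr0.
by rewrite linearZ /= pairing_eta_xi_at // eq_sym (negbTE kl) mulr0.
Qed.

Lemma local_scalar_curvature x : U x ->
  4 * scalar_curvature h (F x) = 4 * alpha * delta * p%:R * (p%:R + 8).
Proof.
apply: (@base_scalar_curvature _ _ _ U V F h Ec xi P J) => //.
- by move=> c d y Uy; rewrite derive_F // T_Ec // mxE andbT.
- by move=> l d y Uy; rewrite derive_F // T_xi_at // mxE.
- by move=> l a b c y; apply: (dP_cyclic oU SEc Sxi SP alpha_neq0 xi_indep bracket_EE bracket_xiE).
- move=> i j k a b y.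
  by apply: (dP_xi oU SEc Sxi SP alpha_neq0 xi_indep bracket_EE bracket_xiE bracket_xixi).
- by move=> a b f y; apply: (commutator_EE oU SEc bracket_EE).
Qed.

End LocalGeometry.

(** * The scalar curvature *)

Lemma contact3_at (R : realType) m (M : manifold R m)
    (phi : 'I_3 -> endo_field M) (xi : 'I_3 -> vector_field M)
    (eta : 'I_3 -> one_form M) (g : riemannian_metric M) c x :
  almost_3_contact_metric phi xi eta g -> atlas c -> crange c x ->
  contact3 (fun i => phi i c x) (fun i => xi i c x) (fun i => eta i c x) (g c x).
Proof.
move=> [acm a3phi a3xi a3eta] ac cx; split.
- exact: rm_sym.
- by move=> i; exact: (acm_phi_sqr (acm i)).
- by move=> i; exact: (acm_eta_xi (acm i)).
- by move=> i; exact: (acm_phi_xi (acm i)).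
- by move=> i; exact: (acm_eta_phi (acm i)).
- by move=> i; exact: (acm_metric (acm i)).
- by move=> i j k e; exact: a3phi.
- by move=> i j k e; exact: a3xi.
- by move=> i j k e; exact: a3eta.
Qed.

Lemma open_chart_preimage (R : realType) m (T : topologicalType) (c : chart R m T) (O : set T) :
  is_chart c -> open O -> open (cmap c @` (cdom c `&` O)).
Proof.
move=> [oD oR mK mc ic] oO.
have -> : cmap c @` (cdom c `&` O) = crange c `&` cinv c @^-1` (cdom c `&` O).
  apply/seteqP; split=> [_ [a [Da Oa] <-]|_ [[a Da <-]]] /=.
    by split; [exists a|rewrite mK].
  by rewrite mK // => -[_ Oa]; exists a.
rewrite openE => x [Rx [Dx Ox]]; rewrite /interior.
apply: filterI; first exact: open_nbhs_nbhs.
move: ic; rewrite continuous_open_subspace // => /(_ x (mem_set Rx)); apply.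
by apply: open_nbhs_nbhs; split=> //; exact: openI.
Qed.

Theorem theorem2p2p2 (R : realType) (n : nat)
    (M : manifold R (4 * n + 3)) (N : manifold R (4 * n))
    (alpha delta : R)
    (phi : 'I_3 -> endo_field M) (xi : 'I_3 -> vector_field M)
    (eta : 'I_3 -> one_form M) (g : riemannian_metric M)
    (gN : riemannian_metric N) (proj : M -> N)
    (HM : three_alpha_delta_Sasaki alpha delta phi xi eta g)
    (Hproj : canonical_submersion xi g gN proj) :
  forall (q : N) (c : chart R (4 * n) N), atlas c -> cdom c q ->
    scalar_curvature (gN c) (cmap c q) =
      16 * n%:R * (n%:R + 2) * alpha * delta.
Proof.
move=> q cN aN Dq.
have [[[pc ps] onto sub iso] ver] := Hproj.
have [a qE] := onto q; have [cM aM Da] := atlas_cover a.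
have chM := atlas_chart aM; have chN := atlas_chart aN.
pose O := cdom cM `&` proj @^-1` cdom cN.
pose U := cmap cM @` O.
have oU : open U.
  by apply: open_chart_preimage => //; apply: open_comp => //; exact: chart_open_dom.
have UR : U `<=` crange cM by move=> _ [b [Db _] <-]; exists b.
pose F := in_charts proj cM cN.
have FE b : O b -> F (cmap cM b) = cmap cN (proj b).
  by move=> [Db _]; rewrite /F /in_charts /= (chart_mapK chM).
have Ux : U (cmap cM a) by exists a => //; split => //=; rewrite qE.
have main := @local_scalar_curvature R (4 * n) U (crange cN) F (gN cN)
  (fun i => phi i cM) (fun i => xi i cM) (fun i => eta i cM) (g cM) alpha delta oU (chart_open_range chN).
have : 4 * scalar_curvature (gN cN) (F (cmap cM a)) =
    4 * alpha * delta * (4 * n)%:R * ((4 * n)%:R + 8).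
  apply: main => //.
  - by move=> _ [b Ob <-]; rewrite FE //; case: Ob => _ Nb; exists (proj b).
  - exact: ps.
  - exact: rm_smooth.
  - by move=> i j k; apply: smooth_sub UR _; exact: ef_smooth.
  - by move=> i j k; apply: smooth_sub UR _; exact: vf_smooth.
  - by move=> i j k; apply: smooth_sub UR _; exact: of_smooth.
  - by move=> j k; apply: smooth_sub UR _; exact: rm_smooth.
  - by move=> y Ry; exact: rm_sym.
  - move=> y Ry; apply: unitmx_inj => v v0; apply/eqP; apply: contraT => vn0.
    have := rm_pos gN aN Ry vn0; rewrite /bilin -mulmxA v0 mulmx0 mxE ltxx //.
  - by move=> y /UR; apply: contact3_at => //; exact: s3_a3c HM.
  - by move=> _ [b [Db Nb] <-] v; exact: ver.
  - move=> _ [b [Db Nb] <-] u v hu hv; rewrite FE //; exact: (iso cM cN b).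
  - move=> i j k e y Uy u v; rewrite (s3_d HM e aM (UR _ Uy)) // => r s; exact: smooth_cst.
  - exact: s3_alpha HM.
rewrite FE ?qE; last by split => //=; rewrite qE.
rewrite natrM; lra.
Qed.
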